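(* Let $x,y$ be nonnegative integers, let $k$ be a positive integer, and let $d_1,\dots,d_{k-1}$ be positive integers with $d_1+\dots+d_{k-1}=x+y$. Let $C_1,\dots,C_k$ be clusters of lengths $f_1,\dots,f_k$ (where $C_1$ and $C_k$ may be empty), with index sets $U_i,D_i\subseteq[f_i]$ and $U_i\cup D_i=[f_i]$, and for each $i$ let $C'_i$ be a cluster obtained from $C_i$ by shuffling the unit triangles at the positions in the symmetric difference of $U_i$ and $D_i$; that is, $C'_i$ has index sets $U'_i,D'_i$ with $U'_i\cup D'_i=U_i\cup D_i$, $U'_i\cap D'_i=U_i\cap D_i$, $|U'_i|=|U_i|$ and $|D'_i|=|D_i|$. Then $$\lim_{N\to\infty}\frac{\operatorname{M}(H_{Nx,Ny}(C_1,\dots,C_k;Nd_1,\dots,Nd_{k-1}))}{\operatorname{M}(H_{Nx,Ny}(C'_1,\dots,C'_k;Nd_1,\dots,Nd_{k-1}))}=\prod_{i=1}^{k}\frac{s^+(C_i)\,s^-(C_i)}{s^+(C'_i)\,s^-(C'_i)},$$ where the limit is over positive integers $N$ and, with $u_i=|U_i|$ and $v_i=|D_i|$, $$s^+(C_i)=\operatorname{M}(S_{u_i,f_i-u_i}(U_i)),\qquad s^-(C_i)=\operatorname{M}(S_{v_i,f_i-v_i}(D_i)),$$ and $s^+(C'_i)=\operatorname{M}(S_{u_i,f_i-u_i}(U'_i))$, $s^-(C'_i)=\operatorname{M}(S_{v_i,f_i-v_i}(D'_i))$.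
   Context: Notation: $[m]=\{1,2,\dots,m\}$. Work on the triangular lattice of the plane with unit-side equilateral triangles, drawn so that one family of lattice lines is horizontal. Each unit triangle is up-pointing (horizontal edge at the bottom) or down-pointing (horizontal edge at the top). A lozenge is the union of two unit triangles sharing an edge. A (lozenge) tiling of a region (a finite union of unit triangles) is a covering of the region by lozenges contained in it, with no gaps and no overlaps. $\operatorname{M}(R)$ denotes the number of lozenge tilings of the region $R$ (equal to $1$ for the empty region). Dented semihexagon: for nonnegative integers $a,b$ and $1\le s_1<\dots<s_a\le a+b$, $S_{a,b}(\{s_1,\dots,s_a\})=S_{a,b}(s_1,\dots,s_a)$ is the region obtained from the upper half of the lattice hexagon with $120^\circ$ angles and side lengths $b,a,a,b,a,a$ (clockwise from the north side), i.e. from the trapezoid with top side $b$, lateral sides $a$ and base $a+b$, by removing the $a$ up-pointing unit triangles whose bottom edges are the segments of the base at positions $s_1,\dots,s_a$ counted from the left. Definition of $H_{x,y}(U;D)$: let $U,D\subseteq[x+y+n]$ (not necessarily disjoint) with $|U|=u$, $|D|=d$, $|U\cup D|=n$. Consider the lattice hexagon with all angles $120^\circ$ and side lengths $x+n-u,\ y+u,\ y+d,\ x+n-d,\ y+d,\ y+u$ in clockwise order starting from the (horizontal) north side; sides of length $0$ are allowed. Let $l$ be the horizontal lattice line through the west and east vertices; its part inside the hexagon consists of $x+y+n$ unit segments labelled $1,\dots,x+y+n$ from left to right. The up-pointing unit triangle at position $i$ lies just above $l$ with bottom edge the $i$-th segment; the down-pointing unit triangle at position $i$ lies just below $l$ with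 top edge the $i$-th segment. $H_{x,y}(U;D)$ is obtained from the hexagon by removing the up-pointing unit triangles at the positions in $U$ and the down-pointing ones at the positions in $D$. Clusters: a cluster $C$ of length $f$ is a chain of contiguous removed unit triangles along $l$ occupying $f$ consecutive positions. It is described by its index sets $U,D\subseteq[f]$ of its up-pointing and down-pointing triangles, positions being counted from the left end of the cluster, with $U\cup D=[f]$ ($U$ and $D$ need not be disjoint); the empty cluster has $f=0$. Given clusters $C_1,\dots,C_k$ of lengths $f_1,\dots,f_k$ with index sets $U_i,D_i\subseteq[f_i]$, and positive integers $d_1,\dots,d_{k-1}$ (the distances between consecutive clusters) with $d_1+\dots+d_{k-1}=x+y$, put $o_i=\sum_{j<i}(f_j+d_j)$, $n=\sum_i f_i$, and define $$H_{x,y}(C_1,\dots,C_k;d_1,\dots,d_{k-1})=H_{x,y}\Big(\bigcup_{i}(o_i+U_i);\ \bigcup_i(o_i+D_i)\Big),$$ where $o+S=\{o+s:s\in S\}$. Thus the clusters appear along $l$ from left to right, $C_1$ is attached to the west vertex, $C_k$ to the east vertex, and $d_i$ is the number of unit segments of $l$ between $C_i$ and $C_{i+1}$. *)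

(* Defs.v *)
(* MathComp / MathComp-Analysis; finite sets are those of mathcomp-finmap. *)
From mathcomp Require Import all_boot all_order all_algebra finmap.

Set Implicit Arguments.
Unset Strict Implicit.
Unset Printing Implicit Defensive.

Import Order.TTheory GRing.Theory Num.Theory.

Local Open Scope fset_scope.
Local Open Scope ring_scope.

(* The pair (i, j) stands for the lattice point i * e1 + j * e2, where
   e1 = (1, 0) and e2 = (1/2, sqrt 3 / 2). *)
Definition vertex := (int * int)%type.

(* ((i, j), true) is the up-pointing unit triangle whose bottom edge runs from
   (i, j) to (i + 1, j); ((i, j), false) is the down-pointing unit triangle
   whose top edge runs from (i, j + 1) to (i + 1, j + 1). Either way the
   triangle lies in the horizontal strip between heights j and j + 1. *)
Definition triangle := (int * int * bool)%type.

Definition vertices (t : triangle) : {fset vertex} :=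
  let: (i, j, up) := t in
  if up then [fset (i, j); (i + 1, j); (i, j + 1)]
  else [fset (i + 1, j); (i, j + 1); (i + 1, j + 1)].

(* Two distinct unit triangles share an edge exactly when they have two common
   vertices. *)
Definition share_edge (t1 t2 : triangle) : bool :=
  #|` vertices t1 `&` vertices t2| == 2%N.

Definition region := {fset triangle}.

Definition lozenges (R : region) : {fset {fset triangle}} :=
  [fset [fset t1; t2] | t1 in R, t2 in [fset t in R | share_edge t1 t]].

(* A tiling is the set of its lozenges. *)
Definition is_tiling (R : region) (T : {fset {fset triangle}}) : bool :=
  (T `<=` lozenges R) &&
  all (fun t => #|` [fset l in T | t \in (l : {fset triangle})]| == 1%N) R.

Definition M (R : region) : nat :=
  #|` [fset T in fpowerset (lozenges R) | is_tiling R T]|.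

(* The (closed) lattice hexagon with 120 degree angles and side lengths
   w - p, p, q, w - q, q, p, clockwise from the north side (p, q <= w). Its west
   vertex is (0, 0) and its east vertex is (w, 0), so that the line l is the
   line j = 0. *)
Definition in_hexagon (w p q : nat) (z : vertex) : bool :=
  [&& 0 <= z.1, z.1 <= w%:Z, 0 <= z.1 + z.2, z.1 + z.2 <= w%:Z,
      - q%:Z <= z.2 & z.2 <= p%:Z].

(* A set of triangles that contains all those of the hexagon. *)
Definition bounding_box (w p q : nat) : region :=
  let box := [fset ((i%:Z, j%:Z - q%:Z) : vertex) | i in iota 0 w,
                                                    j in iota 0 (p + q)] in
  [fset ((z, up) : triangle) | z in box, up in [:: true; false]].

Definition hexagon (w p q : nat) : region :=
  [fset t in bounding_box w p q | all (in_hexagon w p q) (vertices t)].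

(* The up-pointing (resp. down-pointing) unit triangle lying just above (resp.
   below) the i-th unit segment of l, with i counted from 1. *)
Definition up_at (i : nat) : triangle := (i%:Z - 1, 0, true).
Definition down_at (i : nat) : triangle := (i%:Z - 1, - 1, false).

Definition ups (U : {fset nat}) : region := [fset up_at i | i in U].
Definition downs (D : {fset nat}) : region := [fset down_at i | i in D].

(* S_{a,b}(s), for s a subset of [a + b] with a elements. *)
Definition semihexagon (a b : nat) (s : {fset nat}) : region :=
  [fset t in hexagon (a + b) a a | 0 <= t.1.2] `\` ups s.

(* H_{x,y}(U; D), for U, D subsets of [x + y + |U `|` D|]. *)
Definition dented_hexagon (x y : nat) (U D : {fset nat}) : region :=
  hexagon (x + y + #|` U `|` D|) (y + #|` U|) (y + #|` D|)
    `\` (ups U `|` downs D).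

Definition positions (m : nat) : {fset nat} := [fset i in iota 1 m].

Record dent_cluster := Cluster {
  clen : nat;
  cup : {fset nat};
  cdown : {fset nat};
  cup_cdown : cup `|` cdown = positions clen
}.

(* Equal unions force clen C' = clen C. *)
Definition shuffling (C C' : dent_cluster) : Prop :=
  [/\ cup C' `|` cdown C' = cup C `|` cdown C,
      cup C' `&` cdown C' = cup C `&` cdown C,
      #|` cup C'| = #|` cup C| & #|` cdown C'| = #|` cdown C| ].

Definition splus (C : dent_cluster) : nat :=
  M (semihexagon #|` cup C| (clen C - #|` cup C|) (cup C)).
Definition sminus (C : dent_cluster) : nat :=
  M (semihexagon #|` cdown C| (clen C - #|` cdown C|) (cdown C)).

Section ClusterHexagon.
Variables (k : nat) (C : 'I_k -> dent_cluster) (d : 'I_k.-1 -> nat).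

(* The number of positions of l to the left of the i-th cluster. Clusters and
   distances are indexed from 0: d j separates the j-th and j+1-st clusters. *)
Definition offset (i : 'I_k) : nat :=
  (\sum_(j < k | (j < i)%N) clen (C j) + \sum_(j < k.-1 | (j < i)%N) d j)%N.

Definition translate (o : nat) (S : {fset nat}) : {fset nat} :=
  [fset (o + s)%N | s in S].

Definition cluster_hexagon (x y : nat) : region :=
  dented_hexagon x y
    (\bigcup_(i <- enum 'I_k) translate (offset i) (cup (C i)))
    (\bigcup_(i <- enum 'I_k) translate (offset i) (cdown (C i))).

End ClusterHexagon.

(* Main.v *)
Require Import Defs.
From mathcomp Require Import all_classical all_reals all_analysis.
From mathcomp Require Import all_boot all_order all_algebra perm.
From mathcomp Require Import finmap zify ring.

Set Implicit Arguments.
Unset Strict Implicit.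
Unset Printing Implicit Defensive.

Import Order.TTheory GRing.Theory Num.Theory.
Import numFieldNormedType.Exports.

Local Open Scope fset_scope.
Local Open Scope ring_scope.

(** Let vdm s be the Vandermonde product of a set s of positions, the product of
    b - a over all a < b in s.

    By a theorem of Cohn, Larsen and Propp, a semihexagon with the p dents s has
    vdm s / (0! 1! ... (p-1)!) tilings. To see this, look at the lowest strip of
    triangles: its tiling is determined by the vertical lozenges that leave it
    upwards, which are dents of a smaller semihexagon and must interlace with s.
    The determinant of the binomial coefficients C(s_i, j) satisfies the same
    recursion, as its rows telescope when summed over all interlacing sequences,
    and it is a Vandermonde determinant up to factorials
    ([dented_trapezoid_count], [bindet_vdm]).

    Now cut the hexagon with dents U and D along l. If V is the set of positions of
    the vertical lozenges across l, the two halves are semihexagons with dents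
    U | V and D | V. So the number of tilings is, up to factorials that depend on
    the numbers of dents, the sum over all V of y elements that avoid U and D of
    vdm (U | V) * vdm (D | V). In this product vdm U * vdm D factors out, and what
    remains involves U and D only through their union as multisets, hence only
    through their union and their intersection. Shuffling changes neither, so the
    ratio of the two numbers of tilings is exactly that of the products
    vdm U * vdm D ([dented_hexagon_count], [cluster_hexagon_shuffle]).

    When the dents form clusters, vdm U is the product of the vdm of the clusters,
    which give the claimed limit, and of the distances between triangles of
    different clusters. The latter are asymptotically N times a constant that only
    depends on the pair of clusters, and each pair of clusters contributes equally
    many of them before and after shuffling, so their ratio tends to 1
    ([cvg_pair_gap_ratio]). *)

(** * Adjacency of unit triangles *)

Lemma share_edgeC t1 t2 : share_edge t1 t2 = share_edge t2 t1.
Proof. by rewrite /share_edge fsetIC. Qed.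

Lemma in_fset_sep (K : choiceType) (A : {fset K}) (P : pred K) x :
  (x \in [fset z in A | P z]) = (x \in A) && P x.
Proof. by rewrite !inE. Qed.

Lemma card_fset3I (K : choiceType) (a b c : K) (B : {fset K}) :
  uniq [:: a; b; c] ->
  #|` [fset a; b; c] `&` B| = ((a \in B) + (b \in B) + (c \in B))%N.
Proof.
move=> uabc; have -> : [fset a; b; c] `&` B = [fset x in [seq z <- [:: a; b; c] | z \in B]].
  by apply/fsetP => z; rewrite [RHS]in_fset [RHS]mem_filter !inE /= andbC orbA.
rewrite card_fseq undup_id; last exact: filter_uniq.
by rewrite size_filter /= addn0 addnA.
Qed.

(** Adjacency of two unit triangles depends on the difference of their positions
    only through its comparison with -1, 0 and 1 in each coordinate; the code e
    names the four cases, so that adjacency becomes a finite check. *)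
Lemma int_diff_cases (i i' : int) :
  exists2 e : nat, (e < 4)%N & [/\ (i == i') = (e == 0)%N, (i + 1 == i') = (e == 1)%N,
    (i == i' + 1) = (e == 2)%N & (i + 1 == i' + 1) = (e == 0)%N].
Proof.
have [<-|ne] := eqVneq i i'; first by exists 0%N; rewrite //; split; lia.
have [<-|ne1] := eqVneq (i + 1) i'; first by exists 1%N; rewrite //; split; lia.
have [->|ne2] := eqVneq i (i' + 1); first by exists 2%N; rewrite //; split; lia.
by exists 3%N; rewrite //; split; lia.
Qed.

Lemma share_edge_same i j i' j' b : share_edge (i, j, b) (i', j', b) = false.
Proof.
have [e le4 [E1 E2 E3 E4]] := int_diff_cases i i'.
have [f lf4 [F1 F2 F3 F4]] := int_diff_cases j j'.
rewrite /share_edge; case: b; rewrite /= card_fset3I /= ?(inE, xpair_eqE);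
  [|clear; lia| |clear; lia];
rewrite ?(E1, E2, E3, E4, F1, F2, F3, F4);
clear E1 E2 E3 E4 F1 F2 F3 F4;
(case: e le4 => [|[|[|[|e]]]] le4; [..|discriminate le4]);
  (case: f lf4 => [|[|[|[|f]]]] lf4; [..|discriminate lf4]);
  vm_compute; reflexivity.
Qed.

Lemma share_edge_up_down i j i' j' :
  share_edge (i, j, true) (i', j', false) =
  [|| (i' == i) && (j' == j), (i' == i - 1) && (j' == j)
    | (i' == i) && (j' == j - 1)].
Proof.
have -> : (i' == i - 1) = (i == i' + 1) by lia.
have -> : (j' == j - 1) = (j == j' + 1) by lia.
have [e le4 [E1 E2 E3 E4]] := int_diff_cases i i'.
have [f lf4 [F1 F2 F3 F4]] := int_diff_cases j j'.
rewrite (eq_sym i') (eq_sym j') /share_edge /= card_fset3I /= ?(inE, xpair_eqE); last first.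
  by clear; lia.
rewrite ?(E1, E2, E3, E4, F1, F2, F3, F4).
clear E1 E2 E3 E4 F1 F2 F3 F4.
case: e le4 => [|[|[|[|e]]]] le4; [..|discriminate le4];
  (case: f lf4 => [|[|[|[|f]]]] lf4; [..|discriminate lf4]);
  vm_compute; reflexivity.
Qed.

(** * The recursion for the number of tilings *)

Lemma lozengesP R (l : {fset triangle}) :
  reflect (exists t1 t2, [/\ t1 \in R, t2 \in R, share_edge t1 t2 & l = [fset t1; t2]])
          (l \in lozenges R).
Proof.
apply: (iffP (imfset2P _ _ _ _ _)) => /=.
  case=> t1 t1R [t2]; rewrite !inE => /andP[t2R s12] ->; by exists t1, t2.
case=> t1 [t2 [t1R t2R s12 ->]]; exists t1 => //; exists t2 => //.
by rewrite !inE /= t2R.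
Qed.

Definition tilings (R : region) : {fset {fset {fset triangle}}} :=
  [fset T in fpowerset (lozenges R) | is_tiling R T].

Lemma card_sep1P (K : choiceType) (A : {fset K}) (P : pred K) :
  reflect (exists2 a, a \in A /\ P a & forall b, b \in A -> P b -> b = a)
          (#|` [fset x in A | P x]| == 1%N).
Proof.
apply: (iffP idP) => [/cardfs1P [a /fsetP Ea]|[a [aA Pa] uniqa]].
  exists a; first by move: (Ea a); rewrite !inE eqxx /= => /andP.
  by move=> b bA Pb; move: (Ea b); rewrite !inE bA Pb /= => /esym/eqP.
apply/cardfs1P; exists a; apply/fsetP => b; rewrite !inE /=.
by apply/andP/eqP => [[bA Pb]|->]; [exact: uniqa|].
Qed.

Lemma tilingsP R T :
  reflect (T `<=` lozenges R /\
           forall t, t \in R ->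
             exists2 l, l \in T /\ t \in l & forall m, m \in T -> t \in m -> m = l)
          (T \in tilings R).
Proof.
rewrite !inE /= fpowersetE /is_tiling andbA andbb.
apply: (iffP andP) => -[TR cov]; split=> //.
  by move=> t tR; apply/card_sep1P/(allP cov).
by apply/allP => t tR; apply/card_sep1P/cov.
Qed.

Lemma fset2_inj (t : triangle) : injective (fun t' => [fset t; t']).
Proof.
move=> a b /fsetP E.
have: a \in [fset t; b] by rewrite -E !inE eqxx orbT.
rewrite !inE => /orP[/eqP at_|/eqP->//].
have: b \in [fset t; a] by rewrite E !inE eqxx orbT.
by rewrite at_ !inE orbb => /eqP->.
Qed.

(** Removing the lozenge {t, t'} is a bijection onto the tilings of what is left,
    because no other lozenge of the tiling meets it. *)
Lemma card_tilings_with R t t' : t \in R -> t' \in R -> share_edge t t' ->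
  #|` [fset T in tilings R | [fset t; t'] \in T]| = M (R `\` [fset t; t']).
Proof.
move=> tR t'R s; set l := [fset t; t'].
transitivity #|` [fset l |` T | T in tilings (R `\` l)]|; last first.
  rewrite card_in_imfset // => T1 T2 /= T1P T2P E.
  have lN T : T \in tilings (R `\` l) -> l \notin T.
    case/tilingsP => /fsubsetP TR _; apply/negP => /TR /lozengesP [t1 [t2 [t1R _ _ E']]].
    by move: t1R; rewrite in_fsetD E' in_fset2 eqxx.
  by rewrite -(fsetU1K (lN _ T1P)) E fsetU1K // lN.
congr #|` _|; apply/fsetP => T; rewrite in_fset_sep.
have ll : l \in lozenges R by apply/lozengesP; exists t, t'.
apply/andP/imfsetP => [[/tilingsP [TR cov] lT]|[T' /= /tilingsP [T'R cov] ->]].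
  exists (T `\ l); last by rewrite fsetD1K.
  have disj m : m \in T -> m != l -> forall z, z \in m -> z \notin l.
    move=> mT ml z zm; apply/negP => zl.
    have zR : z \in R by move: zl; rewrite !inE => /orP[]/eqP->.
    have [l' _ uni] := cov _ zR; case/eqP: ml.
    by rewrite (uni m) // (uni l).
  apply/tilingsP; split.
    apply/fsubsetP => m; rewrite !inE => /andP[ml mT].
    have /lozengesP [t1 [t2 [t1R t2R s12 Em]]] := fsubsetP TR _ mT.
    apply/lozengesP; exists t1, t2; split=> //; rewrite inE ?t1R ?t2R andbT.
      by apply: (disj m) => //; rewrite Em !inE eqxx.
    by apply: (disj m) => //; rewrite Em !inE eqxx orbT.
  move=> z; rewrite inE => /andP[zl zR]; have [m [mT zm] uni] := cov _ zR.
  exists m; last by move=> m'; rewrite !inE => /andP[_]; exact: uni.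
  split=> //; rewrite !inE mT andbT; apply: contraNneq zl => <-; exact: zm.
split; last by rewrite in_fset1U eqxx.
have subl m : m \in T' -> forall z, z \in m -> (z \notin l) && (z \in R).
  move=> mT' z; have /lozengesP [t1 [t2 [t1R t2R s12 ->]]] := fsubsetP T'R _ mT'.
  by move: t1R t2R; rewrite !in_fsetD in_fset2 => ? ? /orP[]/eqP->.
apply/tilingsP; split.
  apply/fsubsetP => m; rewrite !in_fsetU in_fset1 => /orP[/eqP->//|mT'].
  have /lozengesP [t1 [t2 [t1R t2R s12 Em]]] := fsubsetP T'R _ mT'.
  by move: t1R t2R; rewrite !in_fsetD => /andP[_ ?] /andP[_ ?]; apply/lozengesP; exists t1, t2.
move=> z zR; have [zl|zl] := boolP (z \in l).
  exists l; first by rewrite in_fset1U eqxx.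
  move=> m; rewrite in_fset1U => /orP[/eqP//|/subl H /H]; by rewrite zl.
have zD : z \in R `\` l by rewrite in_fsetD zl.
have [m [mT' zm] uni] := cov z zD.
exists m; first by rewrite in_fset1U mT' orbT.
move=> m'; rewrite in_fset1U => /orP[/eqP-> zl'|]; last exact: uni.
by rewrite zl' in zl.
Qed.

(** Every tiling covers t by exactly one lozenge {t, t'}. Together with [M0] this
    recursion determines M, and all later counts rest on it alone. *)
Lemma M_peel (R : region) t : t \in R ->
  M R = (\sum_(t' <- R | share_edge t t') M (R `\` [fset t; t']))%N.
Proof.
move=> tR; rewrite /M -/(tilings _) card_fset_sum1.
transitivity (\sum_(T <- tilings R) \sum_(t' <- R | share_edge t t') ([fset t; t'] \in T))%N.
  apply: eq_fbigr => T /tilingsP [TR cov] _.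
  have [l [lT tl] uni] := cov _ tR.
  have [t0 [t0R s0 El]] : exists t0, [/\ t0 \in R, share_edge t t0 & l = [fset t; t0]].
    have /lozengesP [t1 [t2 [t1R t2R s12 El]]] := fsubsetP TR _ lT.
    move: tl; rewrite El !inE => /orP[]/eqP->; first by exists t2.
    by exists t1; rewrite share_edgeC fsetUC.
  rewrite (big_rem t0) //= s0 -El lT big_seq_cond big1 ?addn0 // => t' /andP[].
  rewrite mem_rem_uniq ?fset_uniq // inE => /andP[nt t'R] s'.
  apply/eqP; rewrite eqb0; apply: contraNN nt => t'T.
  by rewrite -(inj_eq (@fset2_inj t)) -El; apply/eqP/uni => //; rewrite !inE eqxx.
rewrite exchange_big /=; apply: eq_fbigr => t' t'R s.
rewrite -/(tilings _) -/(M _) -card_tilings_with //.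
rewrite card_fset_sum1 -(big_fset_condE _ (tilings R) (fun T => [fset t; t'] \in T)).
rewrite [RHS]big_mkcond /=.
by apply: eq_bigr => T _; case: ifP.
Qed.

Lemma M0 : M fset0 = 1%N.
Proof.
rewrite /M -/(tilings _); apply/eqP/cardfs1P; exists fset0; apply/fsetP => T.
rewrite in_fset1; apply/tilingsP/eqP => [[TR _]|->].
  apply/eqP; rewrite -fsubset0; apply/fsubsetP => l /(fsubsetP TR) /lozengesP [t1 [t2 [t1R _ _ _]]].
  by rewrite in_fset0 in t1R.
by split=> [|t]; rewrite ?fsub0set // in_fset0.
Qed.

(** The induction that follows the recursion of [M_peel]. *)
Lemma M_ind (P : region -> Prop) :
  P fset0 ->
  (forall R t, t \in R ->
     (forall t', t' \in R -> share_edge t t' -> P (R `\` [fset t; t'])) -> P R) ->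
  forall R, P R.
Proof.
move=> P0 PS R; have [n leRn] := ubnP #|` R|.
elim: n R leRn => // n IHn R leRn.
have [->//|/fset0Pn [t tR]] := eqVneq R fset0.
apply: (PS _ t) => // t' t'R s; apply: IHn.
have /fsubset_leq_card : (R `\` [fset t; t']) `<=` R `\ t.
  by apply: fsetDS; apply/fsubsetP => z; rewrite !inE => ->.
by move: leRn; rewrite (cardfsD1 t) tR; lia.
Qed.

Local Opaque M share_edge.

Lemma M_imfset (phi : triangle -> triangle) (R : region) :
  injective phi -> (forall a b, share_edge (phi a) (phi b) = share_edge a b) ->
  M [fset phi t | t in R] = M R.
Proof.
move=> inj_phi adj_phi; move: R; apply: M_ind => [|R t tR IH].
  by congr M; apply/fsetP => t; rewrite in_fset0; apply/imfsetP => -[].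
have ptR : phi t \in [fset phi t | t in R] by rewrite mem_imfset.
rewrite (M_peel ptR) (M_peel tR) big_mkcond big_imfset /=; last by move=> a b _ _ /inj_phi.
rewrite [RHS]big_mkcond; apply: eq_fbigr => t' t'R _; rewrite adj_phi.
case s: (share_edge t t'); last reflexivity.
rewrite -[RHS](IH _ t'R s).
congr M; apply/fsetP => z.
rewrite in_fsetD in_fset2.
apply/andP/imfsetP => [[nz /imfsetP [w /= wR Ez]]|[w /=]].
  exists w; last by [].
  rewrite in_fsetD in_fset2 wR andbT; apply: contra nz; rewrite Ez.
  by case/orP => /eqP ->; rewrite eqxx ?orbT.
rewrite in_fsetD in_fset2 => /andP[nw wR] ->.
by rewrite !(inj_eq inj_phi) mem_imfset.
Qed.

(** * Cutting a region in two *)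

Lemma perm_fsetU_disjoint (K : choiceType) (A B : {fset K}) : [disjoint A & B] ->
  perm_eq (A `|` B) (A ++ B).
Proof.
move=> /fdisjointP dAB; apply: uniq_perm; rewrite ?cat_uniq ?fset_uniq ?andbT //=.
  by apply/hasPn => b bB; apply: contraL bB => /dAB.
by move=> z; rewrite mem_cat in_fsetU.
Qed.

Lemma fsetUD2 (K : choiceType) (A B : {fset K}) a b : a \notin B -> b \notin A ->
  (A `|` B) `\` [fset a; b] = (A `\ a) `|` (B `\ b).
Proof.
move=> aB bA; apply/fsetP => z; rewrite !inE negb_or.
case: (eqVneq z a) => [->|_]; first by rewrite /= (negbTE aB) andbF.
by case: (eqVneq z b) => [->|_]; rewrite //= (negbTE bA).
Qed.

Lemma imfset_setU1 (I : finType) (f : I -> triangle) (i : I) (V : {set I}) :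
  [fset f j | j in i |: V] = f i |` [fset f j | j in V].
Proof.
apply/fsetP => z; rewrite in_fset1U; apply/imfsetP/orP => /=.
  by case=> j /setU1P [->|jV] ->; [left|right; apply/imfsetP; exists j].
case=> [/eqP->|/imfsetP [j /= jV ->]]; first by exists i; rewrite ?setU11.
by exists j => //; rewrite setU1r.
Qed.

Section Split.
Variables (I : finType) (f g : I -> triangle).
Hypotheses (inj_f : injective f) (inj_g : injective g).
Hypothesis adj_fg : forall i, share_edge (f i) (g i).

(** The lozenges {f i, g i} are those that may straddle the common boundary of A
    and B; V indexes a set of them that the two parts have room for. *)
Definition crossable (A B : region) (V : {set I}) : bool :=
  [forall i in V, (f i \in A) && (g i \in B)].

(** Cutting a region along a line: once the lozenges that cross the line are
    fixed, the two sides are tiled independently. The induction on A peels one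
    triangle t of A; its partner lies in A, or is the only triangle of B that
    faces t across the line. *)
Lemma M_split (A B : region) : [disjoint A & B] ->
  (forall a b, a \in A -> b \in B -> share_edge a b -> exists2 i, a = f i & b = g i) ->
  M (A `|` B) = (\sum_(V : {set I} | crossable A B V)
                   M (A `\` [fset f i | i in V]) * M (B `\` [fset g i | i in V]))%N.
Proof.
have [n leAn] := ubnP #|` A|; elim: n A B leAn => // n IHn A B leAn dAB cross.
have [A0|/fset0Pn [t tA]] := eqVneq A fset0.
  rewrite (big_pred1 set0).
    rewrite A0 fset0U fset0D M0 mul1n; congr M; apply/fsetP => z; rewrite in_fsetD.
    by rewrite (_ : z \in [fset _ | _ in _] = false) //; apply/imfsetP => -[i] /=; rewrite in_set0.
  move=> V; apply/forall_inP/eqP => [ok|->]; last by move=> i; rewrite in_set0.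
  by apply/setP => i; rewrite in_set0; apply/negP => /ok; rewrite A0 in_fset0.
have subIH A' B' : A' `<=` A -> t \notin A' -> B' `<=` B ->
  M (A' `|` B') = (\sum_(V : {set I} | crossable A' B' V)
                   M (A' `\` [fset f i | i in V]) * M (B' `\` [fset g i | i in V]))%N.
  move=> sA tA' sB; apply: IHn.
  - apply: leq_trans (_ : #|` A'|.+1 <= n)%N => //.
    have : A' `<=` A `\ t by rewrite fsubsetD1 sA.
    by move=> /fsubset_leq_card; move: leAn; rewrite (cardfsD1 t) tA; lia.
  - by apply: fdisjointWl sA _; apply: fdisjointWr sB _.
  - by move=> a b /(fsubsetP sA) aA /(fsubsetP sB); exact: cross.
have tAB : t \in A `|` B by rewrite in_fsetU tA.
rewrite (M_peel tAB) (perm_big _ (perm_fsetU_disjoint dAB)) big_cat /=.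
rewrite [RHS](bigID (fun V : {set I} => t \notin [fset f i | i in V])) /=.
congr (_ + _)%N.
  (* the tilings in which the lozenge of t stays inside A *)
  transitivity (\sum_(t' <- A | share_edge t t') \sum_(V : {set I} | crossable (A `\` [fset t; t']) B V)
     M ((A `\` [fset t; t']) `\` [fset f i | i in V]) * M (B `\` [fset g i | i in V]))%N.
    apply: eq_fbigr => t' t'A s; rewrite -subIH ?fsubsetDl ?in_fsetD ?in_fset2 ?eqxx //.
    congr M; rewrite fsetDUl; congr (_ `|` _); apply/fsetP => z; rewrite in_fsetD in_fset2.
    case zB: (z \in B); rewrite ?andbF // andbT; apply/norP.
    by split; apply: contraTneq zB => ->; rewrite (fdisjointP dAB).
  rewrite (exchange_big_dep (fun V : {set I} => crossable A B V && (t \notin [fset f i | i in V]))) /=; last first.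
    move=> t' V s ok; apply/andP; split.
      by apply/forall_inP => i /(forall_inP ok); rewrite in_fsetD => /andP[/andP[_ ->] ->].
    apply/imfsetP => -[i /= /(forall_inP ok)]; rewrite in_fsetD in_fset2 => /andP[/andP[]].
    by rewrite negb_or => /andP[/eqP ne _ _ _] /esym.
  apply: eq_bigr => V /andP[ok tV].
  have tAV : t \in A `\` [fset f i | i in V] by rewrite in_fsetD tV.
  rewrite (M_peel tAV) big_distrl /= [LHS]big_mkcond [RHS]big_mkcond /=.
  rewrite -(@big_fset_incl _ _ _ _ (A `\` [fset f i | i in V]) A) ?fsubsetDl //; last first.
    move=> t' t'A; rewrite in_fsetD t'A andbT negbK => /imfsetP [i /= iV Et'].
    case: ifP => // /andP[_ /forall_inP /(_ i iV)].
    by rewrite in_fsetD in_fset2 Et' eqxx orbT.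
  apply: eq_fbigr => t'; rewrite in_fsetD => /andP[t'V t'A] _.
  case s: share_edge => //=; rewrite ifT; last first.
    apply/forall_inP => i iV; have /andP[fA gB] := forall_inP ok i iV.
    rewrite gB in_fsetD fA in_fset2 !andbT; apply/norP; split.
      by apply: contraNneq tV => <-; apply/imfsetP; exists i.
    by apply: contraNneq t'V => <-; apply/imfsetP; exists i.
  by congr (M _ * _)%N; rewrite !fsetDDl fsetUC.
(* the tilings in which the lozenge of t is a crossing one; f being injective,
   there is at most one such lozenge *)
have [[i0 Et gB]|noi] : (exists2 i, t = f i & g i \in B) \/ (forall i, t = f i -> g i \notin B).
  case: (boolP [exists i, (t == f i) && (g i \in B)]) => [/existsP [i /andP[/eqP]]|/existsPn H].
    by left; exists i.
  by right => i E; have := H i; rewrite E eqxx.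
- rewrite (big_rem (g i0)) //= Et adj_fg big_seq_cond big1 ?addn0; last first.
    move=> b /andP[]; rewrite mem_rem_uniq ?fset_uniq // inE => /andP[nb bB] s.
    rewrite Et in tA; have [i Ei Eb] := cross _ _ tA bB s.
    by rewrite Eb (inj_f Ei) eqxx in nb.
  have fB : f i0 \notin B by rewrite -Et (fdisjointP dAB).
  have gA : g i0 \notin A by rewrite (fdisjointP_sym dAB).
  rewrite (fsetUD2 fB gA).
  rewrite subIH ?fsubD1set ?fsubsetDl ?in_fsetD1 -?Et ?eqxx //.
  have tV (V : {set I}) : (t \in [fset f i | i in V]) = (i0 \in V).
    by rewrite Et mem_imfset.
  rewrite [RHS](reindex_onto (fun V => i0 |: V) (fun V => V :\ i0)) /=; last first.
    by move=> V /andP[_]; rewrite negbK tV => /setD1K.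
  apply: eq_big => V.
    rewrite negbK tV setU11 andbT; apply/forall_inP/andP => [ok|[ok /eqP niV] i iV].
      have niV : i0 \notin V by apply/negP => /ok; rewrite in_fsetD1 -Et eqxx.
      rewrite setU1K // eqxx; split=> //; apply/forall_inP => i /setU1P [->|/ok].
        by rewrite -Et tA gB.
      by rewrite !in_fsetD1 => /andP[/andP[_ ->] /andP[_ ->]].
    have /andP[fA gB'] := forall_inP ok i (setU1r _ iV).
    have nei : i != i0 by apply: contraTneq iV => ->; rewrite -niV setD11.
    by rewrite !in_fsetD1 fA gB' Et !inj_eq // nei.
  by move=> ok; rewrite !imfset_setU1 Et -!fsetDDl.
rewrite big_seq_cond big1; last first.
  move=> b /andP[bB /(cross _ _ tA bB) [i Et Eb]].
  by have := noi i Et; rewrite -Eb bB.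
rewrite big1 // => V /andP[ok]; rewrite negbK => /imfsetP [i /= iV Et].
by have := noi i Et; have /andP[_ ->] := forall_inP ok i iV.
Qed.
End Split.

(** * Interlacing sequences and binomial determinants *)

(** [interlace x s t] says that x <= t_0 < s_0 <= t_1 < s_1 <= ..., that is, that t
    interlaces with x :: s, as two consecutive rows of a Gelfand-Tsetlin pattern
    do. *)
Fixpoint interlace (x : nat) (s t : seq nat) : bool :=
  match s, t with
  | [::], [::] => true
  | y :: s', z :: t' => [&& (x <= z)%N, (z < y)%N & interlace y s' t']
  | _, _ => false
  end.

Fixpoint interlacings (x : nat) (s : seq nat) : seq (seq nat) :=
  if s is y :: s' then [seq z :: t | z <- iota x (y - x), t <- interlacings y s']
  else [:: [::]].

Lemma mem_interlacings x s t : (t \in interlacings x s) = interlace x s t.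
Proof.
elim: s x t => [|y s IHs] x [|z t] //=.
  by apply/negbTE/allpairsP => -[[? ?] []].
apply/allpairsP/and3P => [[[z' t'] /= [zi ti [-> ->]]]|[xz zy ist]].
  by move: zi ti; rewrite mem_iota IHs => ? ?; split=> //; lia.
by exists (z, t); rewrite /= mem_iota IHs; split=> //; lia.
Qed.

Lemma interlacings_uniq x s : uniq (interlacings x s).
Proof.
elim: s x => //= y s IHs x; apply: allpairs_uniq; rewrite ?iota_uniq ?IHs //.
by move=> [a b] [c d] _ _ /= [-> ->].
Qed.

Lemma interlace_size x s t : interlace x s t -> size t = size s.
Proof. by elim: s x t => [|y s IHs] x [|z t] //= /and3P[_ _ /IHs->]. Qed.

Lemma interlace_sorted x s t : interlace x s t ->
  sorted ltn t && all (fun z => z < last x s)%N t && all (leq x) t.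
Proof.
elim: s x t => [|y s IHs] x [|z t] //= /and3P[xz zy ist].
have /andP[/andP[st lt_] yt] := IHs _ _ ist.
have zt : all (ltn z) t by apply: sub_all yt => k /=; lia.
rewrite path_sortedE; last exact: ltn_trans.
rewrite zt st lt_ xz /= andbT; apply/andP; split; last by apply: sub_all yt => k /=; lia.
by case: t ist lt_ zt {IHs st yt} => [|k t] /=; [case: s|lia].
Qed.

Definition bindet (n : nat) (s : seq nat) : int :=
  \det (\matrix_(i < n, j < n) ('C(nth 0 s i, j))%:Z).

(** The entries of an interlacing sequence range independently of each other over
    consecutive intervals, so a sum of products is a product of sums. *)
Lemma sum_interlacings_prod x s (g : 'I_(size s) -> nat -> int) :
  \sum_(t <- interlacings x s) \prod_(i < size s) g i (nth 0 t i) =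
  \prod_(i < size s) \sum_(nth 0%N (x :: s) i <= z < nth 0%N s i) g i z.
Proof.
elim: s x g => [|y s IHs] x g /=; first by rewrite big_seq1 !big_ord0.
rewrite big_allpairs_dep big_ord_recl /= mulr_suml /index_iota.
apply: eq_bigr => z _; rewrite -(IHs y (fun i => g (lift ord0 i))) mulr_sumr.
by apply: eq_bigr => t _; rewrite big_ord_recl.
Qed.

(** Pascal's rule telescopes. *)
Lemma sum_bin x y j : (x <= y)%N ->
  \sum_(x <= z < y) ('C(z, j))%:Z = ('C(y, j.+1))%:Z - ('C(x, j.+1))%:Z :> int.
Proof.
move=> xy; rewrite -(telescope_sumr (fun z => ('C(z, j.+1))%:Z : int)) //.
by apply: eq_bigr => z _; rewrite binS PoszD addrAC subrr add0r.
Qed.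

(** The first column of the binomial matrix consists of ones: subtracting from each
    row the previous one and expanding along that column lowers the size by 1. *)
Lemma bindet_diff n s :
  bindet n.+1 s = \det (\matrix_(i < n, j < n)
    (('C(nth 0 s i.+1, j.+1))%:Z - ('C(nth 0 s i, j.+1))%:Z) : 'M[int]_n).
Proof.
pose L : 'M[int]_n.+1 := \matrix_(i, j) ((i == j)%:R - (i == j.+1 :> nat)%:R).
pose B : 'M[int]_n.+1 := \matrix_(i < n.+1, j < n.+1) ('C(nth 0 s i, j))%:Z.
have detL : \det L = 1.
  rewrite det_trig; last first.
    apply/is_trig_mxP => i j ij; rewrite mxE.
    have -> : (i == j) = false by apply/eqP => E; rewrite E ltnn in ij.
    have -> : (i == j.+1 :> nat) = false by lia.
    by rewrite subr0.
  rewrite big1 // => i _; rewrite mxE eqxx.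
  have -> : (i == i.+1 :> nat) = false by lia.
  by rewrite subr0.
have LB0 j : (L *m B) ord0 j = B ord0 j.
  rewrite !mxE (bigD1 ord0) //= !mxE eqxx subr0 mul1r big1 ?addr0 // => k k0.
  by rewrite !mxE eq_sym (negbTE k0) subr0 mul0r.
have LBS (i : 'I_n) j : (L *m B) (lift ord0 i) j = B (lift ord0 i) j - B (widen_ord (leqnSn n) i) j.
  rewrite [LHS]mxE.
  under eq_bigr do rewrite [L _ _]mxE mulrBl.
  rewrite sumrB; congr (_ - _).
    rewrite (bigD1 (lift ord0 i)) //= eqxx mul1r big1 ?addr0 // => k k0.
    by rewrite eq_sym (negbTE k0) mul0r.
  rewrite (bigD1 (widen_ord (leqnSn n) i)) //= eqxx mul1r big1 ?addr0 // => k k0.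
  case: eqP => [/= E|_]; last by rewrite mul0r.
  by case/eqP: k0; apply: val_inj => /=; move: E; rewrite /bump /=; lia.
have -> : bindet n.+1 s = \det (L *m B) by rewrite det_mulmx detL mul1r.
rewrite (expand_det_col _ ord0) big_ord_recl big1 ?addr0; last first.
  by move=> i _; rewrite LBS !mxE !bin0 subrr mul0r.
rewrite LB0 mxE bin0 mul1r /cofactor /= expr0 mul1r; congr (\det _).
apply/matrixP => i j; rewrite [LHS]mxE [LHS]mxE LBS !mxE.
by rewrite /= /bump /= !add1n.
Qed.

(** By multilinearity in the rows, summing the determinant over all interlacing
    sequences sums each row over an interval. Since binomial coefficients
    telescope, this gives the differences of consecutive rows in [bindet_diff].
    So binomial determinants obey the row recursion of the tilings of a dented
    trapezoid. *)
Lemma sum_bindet_interlacings x s : path leq x s ->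
  \sum_(t <- interlacings x s) bindet (size s) t = bindet (size s).+1 (x :: s).
Proof.
move=> xs; rewrite bindet_diff /bindet /determinant exchange_big /=.
apply: eq_bigr => sg _; rewrite -mulr_sumr; congr (_ * _).
transitivity (\sum_(t <- interlacings x s) \prod_(i < size s) (('C(nth 0 t i, sg i))%:Z : int)).
  by apply: eq_bigr => t _; apply: eq_bigr => i _; rewrite mxE.
rewrite (sum_interlacings_prod x (fun i z => ('C(z, sg i))%:Z)).
apply: eq_bigr => i _; rewrite mxE sum_bin //.
by apply: (pathP 0%N xs).
Qed.

Lemma horner_ffact (m j : nat) :
  (\prod_(l < j) ('X - (l%:Z)%:P)).[m%:Z] = (m ^_ j)%:Z :> int.
Proof.
elim: j => [|j IHj]; first by rewrite big_ord0 hornerC ffactn0.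
rewrite big_ord_recr /= hornerM IHj hornerXsubC ffactnSr PoszM.
have [jm|mj] := leqP j m; first by rewrite subzn.
by rewrite ffact_small // !mul0r.
Qed.

(** Up to the factor j! in column j, the entries are falling factorials, monic
    polynomials of degree j in s_i, so the matrix is a Vandermonde matrix times a
    unitriangular one. *)
Lemma bindet_Vandermonde n (s : seq nat) :
  bindet n s * \prod_(j < n) (j`!)%:Z =
  \prod_(i < n) \prod_(j < n | (i < j)%N) ((nth 0%N s j)%:Z - (nth 0%N s i)%:Z).
Proof.
pose p (j : nat) : {poly int} := \prod_(l < j) ('X - (l%:Z)%:P).
have mp j : p j \is monic by apply: monic_prod_XsubC.
have sp j : size (p j) = j.+1.
  by rewrite /p size_prod_XsubC /index_enum unlock -enumT size_enum_ord.
pose a : 'rV[int]_n := \row_j (nth 0%N s j)%:Z.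
pose P : 'M[int]_n := \matrix_(l, j) (p j)`_l.
have detP : \det P = 1.
  rewrite -det_tr det_trig; last first.
    by apply/is_trig_mxP => i j ij; rewrite !mxE nth_default // sp.
  rewrite big1 // => i _; rewrite !mxE.
  by have /monicP := mp i; rewrite lead_coefE sp.
have := det_Vandermonde a.
under eq_bigr do under eq_bigr do rewrite !mxE.
move <-; have -> : \det (Vandermonde n a) = \det ((Vandermonde n a)^T *m P).
  by rewrite det_mulmx detP mulr1 det_tr.
have -> : \prod_(j < n) (j`!)%:Z = \det (diag_mx (\row_(j < n) (j`!)%:Z)) :> int.
  by rewrite det_diag; apply: eq_bigr => j _; rewrite mxE.
rewrite /bindet -det_mulmx; congr (\det _); apply/matrixP => i j.
rewrite mul_mx_diag !mxE -PoszM bin_ffact -horner_ffact -/(p j).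
rewrite (horner_coef_wide (n := n)) ?sp ?ltn_ord //.
by apply: eq_bigr => l _; rewrite !mxE mulrC.
Qed.

Definition vdm (s : seq nat) : nat := (\prod_(a <- s) \prod_(b <- s | a < b) (b - a))%N.

Definition superfact (n : nat) : nat := (\prod_(j < n) j`!)%N.

Lemma natz_prod (I : Type) (r : seq I) (P : pred I) (F : I -> nat) :
  (\prod_(i <- r | P i) F i)%N%:Z = \prod_(i <- r | P i) (F i)%:Z.
Proof. by rewrite -natz natr_prod; apply: eq_bigr => i _; rewrite natz. Qed.

Lemma bindet_vdm (s : seq nat) : sorted ltn s ->
  bindet (size s) s * (superfact (size s))%:Z = (vdm s)%:Z.
Proof.
move=> ss; rewrite /superfact /vdm !natz_prod bindet_Vandermonde.
rewrite (big_nth 0%N) big_mkord; apply: eq_bigr => i _.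
rewrite (big_nth 0%N) big_mkord natz_prod.
have mono := sorted_ltn_nth ltn_trans 0%N ss.
apply: eq_big => j.
  apply/idP/idP => [ij|]; first by apply: mono; rewrite ?inE.
  apply: contraTT; rewrite -!leqNgt => ji.
  have [->//|ne] := eqVneq (i : nat) j.
  by apply: ltnW; apply: mono; rewrite ?inE ?ltn_ord //; lia.
move=> ij; have lij : (nth 0 s i < nth 0 s j)%N by apply: mono; rewrite ?inE.
by rewrite subzn // ltnW.
Qed.

(** * Tilings of a horizontal strip *)

(** The triangles of the lowest horizontal strip, numbered from left to right: up
    and down ones alternate and each is adjacent to the next one only, so that the
    strip is a path and its tilings are perfect matchings of a path. *)
Definition strip_triangle (m : nat) : triangle := ((m./2)%:Z, 0, ~~ odd m).

Lemma strip_triangle_inj : injective strip_triangle.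
Proof.
move=> m n [E1 E2]; rewrite -(odd_double_half m) -(odd_double_half n) E1.
by rewrite (negb_inj E2).
Qed.

Lemma share_edge_strip m n :
  share_edge (strip_triangle m) (strip_triangle n) = (m == n.+1) || (n == m.+1).
Proof.
wlog om : m n / ~~ odd m.
  move=> H; case om: (odd m); last by rewrite H ?om.
  case on: (odd n); last by rewrite share_edgeC H ?on // orbC.
  rewrite /strip_triangle om on share_edge_same; symmetry; lia.
case on: (odd n); last first.
  rewrite /strip_triangle om on share_edge_same; symmetry; lia.
rewrite /strip_triangle om on /= share_edge_up_down; lia.
Qed.

Fixpoint paired (s : seq nat) : bool :=
  match s with
  | [::] => true
  | [:: _] => false
  | m :: n :: s' => (n == m.+1) && paired s'
  end.

(** The leftmost triangle of the strip must be matched with the next one. *)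
Lemma M_strip s : sorted ltn s ->
  M [fset strip_triangle m | m in s] = paired s :> nat.
Proof.
have [n les] := ubnP (size s); elim: n s les => // n IHn [|m s] les ss.
  apply: etrans M0; congr M; apply/fsetP => t; rewrite in_fset0.
  by apply/negbTE/imfsetP => -[].
have us : uniq (m :: s) by apply: sorted_uniq ss; [exact: ltn_trans|exact: ltnn].
have mR : strip_triangle m \in [fset strip_triangle m | m in m :: s].
  by apply/imfsetP; exists m => //=; rewrite mem_head.
rewrite (M_peel mR) big_mkcond big_imfset; last by move=> a b _ _ /strip_triangle_inj.
rewrite (_ : enum_finmem _ = m :: s); last exact: undup_id.
rewrite big_cons share_edge_strip; have -> : (m == m.+1) = false by lia.
rewrite /= add0n.
case: s les ss us mR => [|k s] les ss us mR; first by rewrite big_nil.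
have mk : (m < k)%N by case/andP: ss.
have ks : all (ltn k) s by case/andP: ss => _; exact: order_path_min ltn_trans.
rewrite big_cons share_edge_strip big_seq big1 ?addn0; last first.
  move=> l ls; rewrite share_edge_strip; have := allP ks l ls => /= kl.
  by have -> : (m == l.+1) || (l == m.+1) = false by lia.
have -> : (m == k.+1) || (k == m.+1) = (k == m.+1) by lia.
rewrite /paired -/paired; case: eqP => [Ek|//] /=.
rewrite -IHn; [|by move: les => /=; lia|by case/andP: ss => _ /path_sorted].
congr M; apply/fsetP => t; rewrite in_fsetD in_fset2.
apply/andP/imfsetP => [[nt /imfsetP [l /= ls Et]]|[l /= ls ->]].
  exists l => //=; move: ls; rewrite !inE => /or3P [/eqP El|/eqP El|//].
    by rewrite Et El eqxx in nt.
  by rewrite Et El eqxx orbT in nt.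
rewrite !(inj_eq strip_triangle_inj) (mem_imfset _ _ strip_triangle_inj) /= !inE ls !orbT.
have /= kl := allP ks l ls; split=> //; lia.
Qed.

(** S and T are the positions of the removed up and down triangles. *)
Definition strip_present (S T : pred nat) (m : nat) : bool :=
  if odd m then ~~ T m./2 else ~~ S m./2.

Definition strip_paired (S T : pred nat) (a n : nat) : bool :=
  paired [seq m <- iota a n | strip_present S T m].

Lemma paired_gap m s : all (fun k => m.+1 < k)%N s -> paired (m :: s) = false.
Proof. by case: s => //= k s /andP[mk _]; case: eqP mk => // ->; rewrite ltnn. Qed.

Lemma all_filter_iota (P : pred nat) m a n : (m < a)%N ->
  all (fun k => m < k)%N [seq k <- iota a n | P k].
Proof.
by move=> ma; apply/allP => k; rewrite mem_filter mem_iota => /and3P[_ ? _]; lia.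
Qed.

Lemma sorted_head i s : sorted ltn s -> all (leq i) s -> i \in s ->
  exists2 s', s = i :: s' & all (leq i.+1) s'.
Proof.
case: s => //= a s ps /andP[ia _]; have := order_path_min ltn_trans ps => /allP as_.
rewrite inE => /orP[/eqP->|/as_ /= ?]; last by lia.
by exists s => //; apply/allP => b /as_.
Qed.

Lemma all_leqS i s : all (leq i) s -> i \notin s -> all (leq i.+1) s.
Proof.
move=> /allP is_ ni; apply/allP => a as_; have /= := is_ a as_.
by rewrite leq_eqVlt => /orP[/eqP E|//]; rewrite E as_ in ni.
Qed.

Section StripPaired.
Variables S T : pred nat.

Lemma strip_present_even i : strip_present S T i.*2 = ~~ S i.
Proof. by rewrite /strip_present odd_double doubleK. Qed.

Lemma strip_present_odd i : strip_present S T i.*2.+1 = ~~ T i.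
Proof. by rewrite /strip_present /= odd_double uphalf_double. Qed.

Lemma strip_paired_absent a n : ~~ strip_present S T a ->
  strip_paired S T a n.+1 = strip_paired S T a.+1 n.
Proof. by rewrite /strip_paired /= => /negbTE ->. Qed.

Lemma strip_paired_gap a n : strip_present S T a -> ~~ strip_present S T a.+1 ->
  strip_paired S T a n.+1 = false.
Proof.
rewrite /strip_paired; case: n => [|n] /= -> // /negbTE ->.
by rewrite paired_gap //; apply: all_filter_iota.
Qed.

Lemma strip_paired_step a n : strip_present S T a -> strip_present S T a.+1 ->
  strip_paired S T a n.+2 = strip_paired S T a.+2 n.
Proof. by rewrite /strip_paired /= => -> ->; rewrite /= eqxx. Qed.

(** Reading the strip from left to right, removed up and down triangles must
    alternate, since between two consecutive ones an even number of triangles is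
    left: this is interlacing. The two halves of the statement are the states of
    the scan, at an up triangle and at a down triangle; x is the last removed up
    triangle in the second state. *)
Lemma strip_paired_interlace n :
  (forall i s t, sorted ltn s -> sorted ltn t ->
     all (leq i) s -> all (leq^~ (i + n)%N) s ->
     all (leq i) t -> all (fun k => k < i + n)%N t ->
     (forall k, (i <= k)%N -> S k = (k \in s)) ->
     (forall k, (i <= k)%N -> T k = (k \in t)) ->
     strip_paired S T i.*2 n.*2.+1 = (if s is x :: s' then interlace x s' t else false)) /\
  (forall i x s t, sorted ltn s -> sorted ltn t -> (x <= i)%N ->
     all (leq i.+1) s -> all (leq^~ (i + n)%N) s ->
     all (leq i) t -> all (fun k => k < i + n)%N t ->
     (forall k, (i < k)%N -> S k = (k \in s)) ->
     (forall k, (i <= k)%N -> T k = (k \in t)) ->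
     strip_paired S T i.*2.+1 n.*2 = interlace x s t).
Proof.
elim: n => [|n [IHe IHo]].
  have odd0 i x s t : all (leq i.+1) s -> all (leq^~ (i + 0)%N) s ->
     all (leq i) t -> all (fun k => k < i + 0)%N t -> interlace x s t.
    case: s t => [|a s] [|b t] //=; lia.
  split=> [i s t ss st s1 s2 t1 t2 HS HT|i x s t ss st xi s1 s2 t1 t2 HS HT]; last first.
    by rewrite (odd0 i).
  have [is_|is_] := boolP (i \in s).
    rewrite strip_paired_absent; last by rewrite strip_present_even negbK HS.
    have [s' Es s'1] := sorted_head ss s1 is_; subst s.
    by rewrite (odd0 i) //; case/andP: s2.
  have := all_leqS s1 is_; rewrite /strip_paired /= strip_present_even HS // is_ /=.
  by case: s s2 {HS ss s1 is_} => //= a s; lia.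
have odd_step i x s t : sorted ltn s -> sorted ltn t -> (x <= i)%N ->
     all (leq i.+1) s -> all (leq^~ (i + n.+1)%N) s ->
     all (leq i) t -> all (fun k => k < i + n.+1)%N t ->
     (forall k, (i < k)%N -> S k = (k \in s)) ->
     (forall k, (i <= k)%N -> T k = (k \in t)) ->
     strip_paired S T i.*2.+1 n.+1.*2 = interlace x s t.
  move=> ss st xi s1 s2 t1 t2 HS HT; rewrite -addSnnS in s2 t2; rewrite doubleS.
  have [it|it] := boolP (i \in t).
    rewrite strip_paired_absent; last by rewrite strip_present_odd negbK HT.
    have [t' Et t'1] := sorted_head st t1 it; subst t => /=.
    rewrite -doubleS (IHe _ s t') //.
    - by case: s {ss s1 s2 HS} (s1) => // a s /andP[/= ia _]; rewrite xi ia.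
    - exact: path_sorted st.
    - by case/andP: t2.
    - by move=> k ik; rewrite HT ?inE; [rewrite (gtn_eqF ik)|exact: ltnW].
  have pi_ : strip_present S T i.*2.+1 by rewrite strip_present_odd HT.
  have t1' := all_leqS t1 it.
  have [is_|is_] := boolP (i.+1 \in s).
    rewrite strip_paired_gap //; last by rewrite -doubleS strip_present_even negbK HS.
    have [s' Es s'1] := sorted_head ss s1 is_; subst s.
    by case: t {st t2 HT it t1} t1' => //= z t /andP[? _]; symmetry; lia.
  rewrite strip_paired_step //; last by rewrite -doubleS strip_present_even HS.
  rewrite -doubleS (IHo i.+1 x s t) //.
  - exact: leqW.
  - exact: all_leqS.
  - by move=> k ik; rewrite HS // ltnW.
  - by move=> k ik; rewrite HT // ltnW.
split=> // i s t ss st s1 s2 t1 t2 HS HT.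
have [is_|is_] := boolP (i \in s).
  rewrite strip_paired_absent; last by rewrite strip_present_even negbK HS.
  have [s' Es s'1] := sorted_head ss s1 is_; subst s => /=.
  rewrite (odd_step _ i s' t) //.
  - exact: path_sorted ss.
  - by case/andP: s2.
  - by move=> k ik; rewrite HS ?inE; [rewrite (gtn_eqF ik)|exact: ltnW].
have s1' := all_leqS s1 is_; rewrite -addSnnS in s2 t2.
have pi_ : strip_present S T i.*2 by rewrite strip_present_even HS.
rewrite doubleS; have [it|it] := boolP (i \in t).
  rewrite strip_paired_gap //; last by rewrite strip_present_odd negbK HT.
  have [t' Et t'1] := sorted_head st t1 it; subst t.
  by case: s {ss s1 s2 HS is_} s1' => //= a [|b s] //= /andP[ia _]; symmetry; lia.
rewrite strip_paired_step //; last by rewrite strip_present_odd HT.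
rewrite -doubleS (IHe _ s t) //.
- exact: all_leqS.
- by move=> k ik; rewrite HS // ltnW.
- by move=> k ik; rewrite HT // ltnW.
Qed.

End StripPaired.

(** * Tilings of a dented semihexagon *)

Lemma all_fset3 (K : choiceType) (a b c : K) (P : pred K) :
  all P [fset a; b; c] = [&& P a, P b & P c].
Proof.
apply/allP/and3P => [H|[Pa Pb Pc] z]; last by rewrite !inE => /orP[/orP[]|] /eqP->.
by split; apply: H; rewrite !inE eqxx ?orbT.
Qed.

Lemma mem_hexagon w p q i j b :
  ((i, j, b) \in hexagon w p q) =
  [&& 0 <= i, i + 1 <= w%:Z, 0 <= i + j + (~~ b : nat)%:Z,
      i + j + (~~ b : nat)%:Z + 1 <= w%:Z, - q%:Z <= j & j + 1 <= p%:Z].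
Proof.
rewrite in_fset_sep; apply/andP/idP => [[_]|H].
  by case: b; rewrite /= all_fset3 /in_hexagon /=; lia.
split; last by case: b H; rewrite /= all_fset3 /in_hexagon /=; lia.
apply/imfset2P; exists (i, j); last by exists b; case: (b).
apply/imfset2P; exists `|i|%N => /=; first by rewrite mem_iota; lia.
exists (absz (j + q%:Z)) => /=; first by rewrite mem_iota; lia.
by congr pair; lia.
Qed.

Definition trapezoid w p : region := [fset t in hexagon w p p | 0 <= t.1.2].

Lemma mem_trapezoid w p i j b :
  ((i, j, b) \in trapezoid w p) =
  [&& 0 <= i, 0 <= j, j + 1 <= p%:Z & i + j + (~~ b : nat)%:Z + 1 <= w%:Z].
Proof.
rewrite in_fset_sep mem_hexagon /=.
by apply/idP/idP => H; move: H; case: b => /=; lia.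
Qed.

(** Positions are counted from 0 here, which makes them the upper entries of the
    binomial coefficients in [bindet]. *)
Definition base_up (i : nat) : triangle := (i%:Z, 0, true).
Definition base_ups (s : seq nat) : region := [fset base_up i | i in s].

Definition dented_trapezoid w p (s : seq nat) : region := trapezoid w p `\` base_ups s.

Lemma mem_base_ups s i j b :
  ((i, j, b) \in base_ups s) = [&& b, j == 0, 0 <= i & `|i|%N \in s].
Proof.
apply/imfsetP/and4P => [[k /= ks [-> -> ->]]|[b_ /eqP-> i0 is_]]; first by split.
by exists `|i|%N => //=; rewrite /base_up b_; congr (_, _, _); lia.
Qed.

(** One step in the direction e2: it carries a trapezoid to the part of the next
    larger one that lies above the lowest strip. *)
Definition raise (t : triangle) : triangle := (t.1.1, t.1.2 + 1, t.2).

Lemma raise_inj : injective raise.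
Proof. by move=> [[i j] b] [[i' j'] b'] [-> /addIr-> ->]. Qed.

Lemma share_edge_raise a b : share_edge (raise a) (raise b) = share_edge a b.
Proof.
have H i j i' j' : share_edge (raise (i, j, true)) (raise (i', j', false)) =
    share_edge (i, j, true) (i', j', false).
  rewrite /raise /= !share_edge_up_down (inj_eq (addIr 1)).
  by have -> : (j' + 1 == j + 1 - 1) = (j' == j - 1) by lia.
case: a b => [[i j] []] [[i' j'] []].
- by rewrite !share_edge_same.
- exact: H.
- rewrite share_edgeC H; exact: share_edgeC.
- by rewrite !share_edge_same.
Qed.

Lemma mem_raise i j b (R : region) :
  ((i, j, b) \in [fset raise t | t in R]) = ((i, j - 1, b) \in R).
Proof.
have -> : (i, j, b) = raise (i, j - 1, b) by rewrite /raise /= subrK.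
by rewrite (mem_imfset _ _ raise_inj).
Qed.

Definition strip (w : nat) (S T : pred nat) : region :=
  [fset strip_triangle m | m in [seq m <- iota 0 w.*2.+1 | strip_present S T m]].

Lemma mem_strip w S T i j b :
  ((i, j, b) \in strip w S T) =
  [&& j == 0, 0 <= i, i + (~~ b : nat)%:Z <= w%:Z & if b then ~~ S `|i|%N else ~~ T `|i|%N].
Proof.
rewrite /strip; set l := [seq m <- _ | _].
apply/imfsetP/and4P => [[m ml]|[/eqP-> i0 iw nST]].
  have {ml} : m \in l := ml.
  rewrite mem_filter mem_iota => /andP[pm /andP[_ mw]] [-> -> ->]; split=> //.
    by rewrite negbK; have := odd_double_half m; lia.
  by move: pm; rewrite /strip_present; case: (odd m).
have [n Ei] : exists n : nat, i = n%:Z by exists `|i|%N; lia.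
move: i0 iw nST; rewrite {i}Ei absz_nat; case: b => /= _ nw nST.
  exists n.*2; last by rewrite /strip_triangle odd_double doubleK.
  by change (n.*2 \in l); rewrite mem_filter strip_present_even nST mem_iota; lia.
exists n.*2.+1; last by rewrite /strip_triangle /= odd_double uphalf_double.
by change (n.*2.+1 \in l); rewrite mem_filter strip_present_odd nST mem_iota; lia.
Qed.

Lemma dented_trapezoidS w p s :
  dented_trapezoid w.+1 p.+1 s =
  [fset raise t | t in trapezoid w p] `|` strip w (mem s) pred0.
Proof.
apply/fsetP => -[[i j] b]; rewrite in_fsetD in_fsetU mem_base_ups mem_raise.
rewrite !mem_trapezoid mem_strip /=.
have [->|nj] := eqVneq j 0.
  have -> /= : [&& 0 <= i, 0 <= 0 - 1 :> int, 0 - 1 + 1 <= p%:Z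
                 & i + (0 - 1) + (~~ b : nat)%:Z + 1 <= w%:Z] = false.
    by lia.
  case: (boolP (0 <= i)) => i0; rewrite ?andbF //=.
  have -> : (i + 0 + (~~ b : nat)%:Z + 1 <= w.+1%:Z) = (i + (~~ b : nat)%:Z <= w%:Z) by lia.
  by case: b; rewrite //= andbC.
rewrite /= andbF orbF /=; clear -nj.
have nj' : j <> 0 by apply/eqP.
by case: b => /=; lia.
Qed.

Lemma share_edge_raise_strip w p S T a b :
  a \in [fset raise t | t in trapezoid w p] -> b \in strip w S T -> share_edge a b ->
  exists2 i : 'I_w, a = raise (base_up i) & b = (i%:Z, 0, false).
Proof.
case: a b => [[i j] c] [[i' j'] c']; rewrite mem_raise mem_trapezoid mem_strip.
case: c c' => [] [] /=; rewrite ?share_edge_same //.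
  move=> /and4P[i0 j0 _ iw] /and4P[/eqP-> _ _ _]; rewrite share_edge_up_down => s.
  have ltiw : (`|i|%N < w)%N by lia.
  exists (Ordinal ltiw); rewrite /raise /base_up /=; congr (_, _, _); lia.
move=> /and4P[i0 j0 _ iw] /and4P[/eqP-> _ _ _]; rewrite share_edgeC share_edge_up_down; lia.
Qed.

Definition ordseq (w : nat) (V : {set 'I_w}) : seq nat := [seq val i | i <- enum V].

Lemma ordseq_sorted w (V : {set 'I_w}) : sorted ltn (ordseq V).
Proof.
rewrite /ordseq; apply: (subseq_sorted ltn_trans (s2 := map val (enum 'I_w))); last first.
  by rewrite val_enum_ord iota_ltn_sorted.
by apply: map_subseq; rewrite {1}enumT; apply: filter_subseq.
Qed.

Lemma mem_ordseq w (V : {set 'I_w}) (i : 'I_w) : (val i \in ordseq V) = (i \in V).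
Proof. by rewrite mem_map ?mem_enum //; exact: val_inj. Qed.

Lemma ordseqP w (V : {set 'I_w}) (k : nat) :
  reflect (exists2 i : 'I_w, i \in V & k = i :> nat) (k \in ordseq V).
Proof.
apply: (iffP mapP) => -[i iV ->]; exists i => //; move: iV; by rewrite mem_enum.
Qed.

Lemma ordseq_inj w : injective (@ordseq w).
Proof. by move=> V W E; apply/setP => i; rewrite -!mem_ordseq E. Qed.

Lemma ordseq_surj w t : sorted ltn t -> all (ltn^~ w) t ->
  ordseq [set i : 'I_w | val i \in t] = t.
Proof.
move=> st tw; apply: (irr_sorted_eq ltn_trans ltnn) => //; first exact: ordseq_sorted.
move=> k; apply/ordseqP/idP => [[i]|kt]; first by rewrite inE => ? ->.
by exists (Ordinal (allP tw k kt)); rewrite ?inE.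
Qed.

(** Sets of positions are traded for their increasing enumerations. The bound on
    the last dent ensures that every interlacing sequence arises from a set. *)
Lemma sum_interlacing_sets w x s (F : seq nat -> int) : (last x s <= w)%N ->
  \sum_(V : {set 'I_w} | interlace x s (ordseq V)) F (ordseq V) =
  \sum_(t <- interlacings x s) F t.
Proof.
move=> sw; rewrite -big_filter -(big_map (@ordseq w) xpredT F); apply: perm_big.
apply: uniq_perm; rewrite ?interlacings_uniq ?(map_inj_uniq (@ordseq_inj w)) //.
  by rewrite filter_uniq ?index_enum_uniq.
move=> t; rewrite mem_interlacings; apply/mapP/idP => [[V]|xst].
  by rewrite mem_filter => /andP[? _] ->.
have /andP[/andP[st lt_t] _] := interlace_sorted xst.
have E : ordseq [set i : 'I_w | val i \in t] = t.
  apply: ordseq_surj => //; apply: sub_all lt_t => k /= lk; exact: leq_trans lk sw.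
by exists [set i : 'I_w | val i \in t]; rewrite // mem_filter mem_index_enum E xst.
Qed.

Lemma M_strip_interlace w s t : sorted ltn s -> sorted ltn t ->
  all (leq^~ w) s -> all (ltn^~ w) t ->
  M (strip w (mem s) (mem t)) = (if s is x :: s' then interlace x s' t else false) :> nat.
Proof.
move=> ss st sw tw; rewrite /strip M_strip; last first.
  by apply: (sorted_filter ltn_trans); exact: iota_ltn_sorted.
rewrite -/(strip_paired _ _ _ _) -(double0).
have [H _] := strip_paired_interlace (mem s) (mem t) w.
by rewrite (H 0%N s t) //; [case: s {ss sw H} | apply/allP | apply/allP].
Qed.

(** The Cohn-Larsen-Propp count. The vertical lozenges that straddle the top of the
    lowest strip are dents of the trapezoid above it, the strip can be completed
    exactly when they interlace with s, and then in one way; so both sides satisfy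
    the recursion of [sum_bindet_interlacings]. For p = 0 the region is empty,
    so that there is no triangle to remove: whence the last hypothesis. *)
Lemma dented_trapezoid_count p w s : (p <= w)%N -> sorted ltn s -> all (ltn^~ w) s ->
  (p = 0 -> s = [::])%N ->
  (M (dented_trapezoid w p s))%:Z = if size s == p then bindet p s else 0.
Proof.
elim: p w s => [|p IHp] w s pw ss sw s0.
  rewrite s0 //= /bindet det_mx00.
  suff -> : dented_trapezoid w 0 [::] = fset0 by rewrite M0.
  apply/fsetP => -[[i j] b]; rewrite in_fsetD mem_trapezoid in_fset0.
  by apply/negbTE; rewrite negb_and; apply/orP; right; lia.
case: w pw sw => // w; rewrite ltnS => pw sw.
pose f (i : 'I_w) := raise (base_up i); pose g (i : 'I_w) : triangle := (i%:Z, 0, false).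
have inj_f : injective f by move=> i j /raise_inj [/val_inj].
have inj_g : injective g by move=> i j [/val_inj].
have adj_fg i : share_edge (f i) (g i).
  by rewrite share_edge_up_down; apply/or3P; apply: Or33; rewrite !eqxx.
have E (V : {set 'I_w}) : M ([fset raise t | t in trapezoid w p] `\` [fset f i | i in V])
         = M (dented_trapezoid w p (ordseq V)).
  rewrite -(M_imfset (dented_trapezoid _ _ _) raise_inj share_edge_raise); congr M.
  apply/fsetP => -[[i j] b]; rewrite in_fsetD !mem_raise in_fsetD; congr (~~ _ && _).
  rewrite mem_base_ups; apply/imfsetP/and4P => /=.
    case=> k kV [-> -> ->]; split=> //; by apply/ordseqP; exists k.
  case=> b_ j1 i0 /ordseqP [k kV Ei]; exists k => //.
  rewrite /f /raise /base_up b_ -Ei /=; congr (_, _, _); clear - i0 j1; lia.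
have E' (V : {set 'I_w}) : M (strip w (mem s) pred0 `\` [fset g i | i in V]) =
   (if s is x :: s' then interlace x s' (ordseq V) else false) :> nat.
  rewrite -(M_strip_interlace (w := w)) ?ordseq_sorted //; last first.
    by apply/allP => k /ordseqP [i _ ->] /=.
  congr M; apply/fsetP => -[[i j] b]; rewrite in_fsetD !mem_strip /=.
  have -> : ((i, j, b) \in [fset g i | i in V]) = [&& j == 0, 0 <= i, ~~ b & `|i|%N \in ordseq V].
    apply/imfsetP/and4P => /= [[k kV [-> -> ->]]|[/eqP-> i0 /negbTE-> /ordseqP [k kV Ei]]].
      by split=> //; apply/ordseqP; exists k.
    exists k => //; rewrite /g -Ei; congr (_, _, _); lia.
  by case: (j == 0); case: (0 <= i); case: b; rewrite //= andbT andbC.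
rewrite dented_trapezoidS (M_split inj_f inj_g adj_fg); last 2 first.
- apply/fdisjointP => -[[i j] b]; rewrite mem_raise mem_strip mem_trapezoid.
  by move=> H; apply/negP => /and4P[/eqP j0 _ _ _]; move: H; rewrite j0; lia.
- move=> a b; exact: share_edge_raise_strip.
rewrite -natz natr_sum.
under eq_bigr do rewrite E E' natrM natz.
case: s ss sw s0 E' => [|x s] ss sw s0 _; first by rewrite big1 // => V _; rewrite mulr0.
set A := [fset raise t | t in _]; set B := strip _ _ _.
have fA (i : 'I_w) : (f i \in A) = (0 < p)%N.
  by rewrite mem_raise mem_trapezoid /=; have := ltn_ord i; lia.
have gB (i : 'I_w) : g i \in B by rewrite mem_strip /=; have := ltn_ord i; lia.
have V0 (V : {set 'I_w}) : crossable f g A B V -> p = 0%N -> ordseq V = [::].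
  move=> ok p0; case E2 : (ordseq V) => [|k l] //.
  have /ordseqP [i iV _] : k \in ordseq V by rewrite E2 mem_head.
  by have := forall_inP ok i iV; rewrite fA p0.
have tw (V : {set 'I_w}) : all (ltn^~ w) (ordseq V).
  by apply/allP => k /ordseqP [i _ ->] /=.
rewrite /= eqSS; have [Es|ne] := eqVneq (size s) p; last first.
  rewrite big1 // => V ok; case int: (interlace _ _ _); last by rewrite mulr0.
  rewrite IHp ?ordseq_sorted ?tw //; last exact: V0.
  by rewrite (interlace_size int) (negbTE ne) mul0r.
rewrite -{2}Es -sum_bindet_interlacings; last by apply: sub_path ss => ? ?; exact: ltnW.
rewrite -(sum_interlacing_sets (w := w)); last first.
  by have := allP sw (last x s) (mem_last _ _); rewrite /= ltnS.
rewrite [LHS]big_mkcond [RHS]big_mkcond; apply: eq_bigr => V _.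
case int: (interlace _ _ _); last by rewrite mulr0 if_same.
have sV := interlace_size int.
have ok : crossable f g A B V.
  apply/forall_inP => i iV; rewrite fA gB andbT -Es -sV.
  by case E2: (ordseq V) (mem_ordseq V i) => //; rewrite iV.
by rewrite ok mulr1 IHp ?ordseq_sorted ?tw ?sV ?Es ?eqxx //; exact: V0.
Qed.

(** * Vandermonde products of sets of positions *)

(** The value 1 for b <= a makes products over all ordered pairs meaningful, so
    that [vdm] becomes multiplicative over concatenation with no condition. *)
Definition gap (a b : nat) : nat := if (a < b)%N then (b - a)%N else 1%N.

Definition cross (s t : seq nat) : nat := (\prod_(a <- s) \prod_(b <- t) (gap a b * gap b a))%N.

Lemma gap_gt0 a b : (0 < gap a b)%N.
Proof. by rewrite /gap; case: (ltnP a b) => //; rewrite subn_gt0. Qed.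

Lemma vdm_gap s : vdm s = (\prod_(a <- s) \prod_(b <- s) gap a b)%N.
Proof. by apply: eq_bigr => a _; rewrite big_mkcond. Qed.

Lemma vdm_gt0 s : (0 < vdm s)%N.
Proof. by rewrite vdm_gap; do 2 apply: prodn_gt0 => ?; exact: gap_gt0. Qed.

Lemma cross_gt0 s t : (0 < cross s t)%N.
Proof. by do 2 apply: prodn_gt0 => ?; rewrite muln_gt0 !gap_gt0. Qed.

Lemma vdm_perm s t : perm_eq s t -> vdm s = vdm t.
Proof.
by move=> st; rewrite /vdm (perm_big _ st); apply: eq_bigr => a _; exact: perm_big.
Qed.

Lemma vdm_map (f : nat -> nat) s :
  {in s &, forall a b, gap (f a) (f b) = gap a b} -> vdm [seq f a | a <- s] = vdm s.
Proof.
move=> gf; rewrite !vdm_gap big_map; apply: eq_big_seq => a as_.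
by rewrite big_map; apply: eq_big_seq => b bs; exact: gf.
Qed.

(** Pairs of entries lie in s, in t, or have one entry in each. *)
Lemma vdm_cat s t : vdm (s ++ t) = (vdm s * vdm t * cross s t)%N.
Proof.
rewrite !vdm_gap /cross big_cat /=.
under eq_bigr do rewrite big_cat /=.
under [X in (_ * X)%N]eq_bigr do rewrite big_cat /=.
under [X in _ = (_ * _ * X)%N]eq_bigr do rewrite big_split /=.
rewrite !big_split /= [X in _ = (_ * (_ * X))%N]exchange_big /=; ring.
Qed.

(** As multisets, A + B = (A | B) + (A & B). This is why shuffling the triangles of
    the symmetric difference leaves the interaction with the rest unchanged. *)
Lemma perm_fsetUI (K : choiceType) (A B : {fset K}) :
  perm_eq (A ++ B) ((A `|` B) ++ (A `&` B)).
Proof.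
apply/allP => z _ /=; rewrite !count_cat !count_uniq_mem ?fset_uniq // !inE.
by case: (z \in A); case: (z \in B).
Qed.

Lemma cross_fsetUI (A B : {fset nat}) t :
  (cross A t * cross B t = cross (A `|` B) t * cross (A `&` B) t)%N.
Proof. by rewrite /cross -!big_cat /=; exact/perm_big/perm_fsetUI. Qed.

Lemma mem_positions m k : (k \in positions m) = (0 < k <= m)%N.
Proof. by rewrite in_fset mem_iota add1n ltnS. Qed.

Lemma semihexagonE a b (U : {fset nat}) : semihexagon a b U = trapezoid (a + b) a `\` ups U.
Proof. by []. Qed.

(** [dented_trapezoid_count] for the labels 1, ..., w of the dents; the Vandermonde
    product does not change under translation. *)
Lemma semihexagon_count p w (U : {fset nat}) : (p <= w)%N -> U `<=` positions w ->
  (p = 0%N -> U = fset0) ->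
  (M (trapezoid w p `\` ups U) * superfact p = if #|` U| == p then vdm U else 0)%N.
Proof.
move=> pw /fsubsetP Uw U0.
have Upos k : k \in U -> (0 < k <= w)%N by move=> /Uw; rewrite mem_positions.
set s := [seq k.-1 | k <- sort leq U].
have Us : perm_eq (sort leq U) U by rewrite perm_sort.
have sizes : size s = #|` U| by rewrite size_map (perm_size Us).
have vs : vdm s = vdm U.
  rewrite -(vdm_perm Us); apply: vdm_map => a b; rewrite !mem_sort => /Upos ? /Upos ?.
  rewrite /gap; have -> : (a.-1 < b.-1)%N = (a < b)%N by lia.
  by case: ifP => // _; lia.
have ss : sorted ltn s.
  rewrite sorted_map; have : sorted ltn (sort leq U).
    rewrite ltn_sorted_uniq_leq sort_uniq fset_uniq /=; apply: sort_sorted; exact: leq_total.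
  apply: (@sub_in_sorted _ (mem U)); last by apply/allP => k; rewrite mem_sort.
  by move=> a b /Upos ? /Upos ? /=; lia.
have sw : all (ltn^~ w) s.
  by apply/allP => k /mapP [l]; rewrite mem_sort => /Upos ? -> /=; lia.
have -> : trapezoid w p `\` ups U = dented_trapezoid w p s.
  apply/fsetP => -[[i j] b]; rewrite !in_fsetD mem_base_ups; congr (~~ _ && _).
  apply/imfsetP/and4P => /= [[k kU [-> -> ->]]|].
    split=> //; first by have := Upos _ kU; lia.
    apply/mapP; exists k; rewrite ?mem_sort //; have := Upos _ kU; lia.
  case=> b_ /eqP-> i0 /mapP [k]; rewrite mem_sort => kU Ei.
  exists k => //; rewrite /up_at b_; congr (_, _, _); have := Upos _ kU; clear - i0 Ei; lia.
apply/eqP; rewrite -eqz_nat PoszM; apply/eqP; rewrite dented_trapezoid_count //; last first.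
  by move=> /U0 E; apply/nilP; rewrite /nilp sizes E cardfs0.
rewrite sizes; case: eqP => [Ep|_]; last by rewrite mul0r.
by rewrite -Ep -sizes bindet_vdm // vs.
Qed.

(** * The shuffling theorem for dented hexagons *)

(** The reflection in the horizontal axis l, in the oblique coordinates. *)
Definition reflect_tri (t : triangle) : triangle :=
  let: (i, j, b) := t in (i + j + (~~ b : nat)%:Z, - j - 1, ~~ b).

Lemma reflect_triK : involutive reflect_tri.
Proof. by move=> [[i j] []] /=; congr (_, _, _); lia. Qed.

Lemma share_edge_reflect a b : share_edge (reflect_tri a) (reflect_tri b) = share_edge a b.
Proof.
have H i j i' j' : share_edge (reflect_tri (i, j, true)) (reflect_tri (i', j', false)) =
    share_edge (i, j, true) (i', j', false).
  rewrite /= share_edgeC !share_edge_up_down; apply/or3P/or3P.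
    by case=> /andP[/eqP E1 /eqP E2]; [apply: Or32|apply: Or31|apply: Or33];
    apply/andP; split; apply/eqP; lia.
  by case=> /andP[/eqP E1 /eqP E2]; [apply: Or32|apply: Or31|apply: Or33];
    apply/andP; split; apply/eqP; lia.
case: a b => [[i j] []] [[i' j'] []].
- by rewrite !share_edge_same.
- exact: H.
- rewrite share_edgeC H; exact: share_edgeC.
- by rewrite !share_edge_same.
Qed.

Lemma mem_reflect t (R : region) :
  (t \in [fset reflect_tri u | u in R]) = (reflect_tri t \in R).
Proof. by rewrite -{1}(reflect_triK t) (mem_imfset _ _ (inv_inj reflect_triK)). Qed.

Lemma reflect_up_at i : reflect_tri (up_at i) = down_at i.
Proof. by rewrite /= /down_at; congr (_, _, _); lia. Qed.

Lemma reflect_down_at i : reflect_tri (down_at i) = up_at i.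
Proof. by rewrite -reflect_up_at reflect_triK. Qed.

Lemma mem_reflect_ups t D : (reflect_tri t \in ups D) = (t \in downs D).
Proof.
apply/imfsetP/imfsetP => -[k /= kD E]; exists k => //.
  by rewrite -reflect_up_at -E reflect_triK.
by rewrite E reflect_down_at.
Qed.

Lemma dented_hexagon_split x y (U D : {fset nat}) (w := (x + y + #|` U `|` D|)%N) :
  dented_hexagon x y U D =
    (trapezoid w (y + #|` U|) `\` ups U) `|`
    [fset reflect_tri t | t in trapezoid w (y + #|` D|) `\` ups D].
Proof.
apply/fsetP => t; rewrite in_fsetU mem_reflect !in_fsetD in_fsetU mem_reflect_ups -/w.
case: t => [[i j] b] /=; rewrite mem_hexagon !mem_trapezoid.
have [j0|j0] := boolP (0 <= j).
  have -> : ((i, j, b) \in downs D) = false.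
    by apply/negbTE/imfsetP => -[k _ [_ Ej _]]; move: j0; rewrite Ej.
  have -> /= : (0 <= - j - 1) = false by lia.
  rewrite orbF !andbF orbF; congr (_ && _).
  by apply/idP/idP; case: b; clear - j0; lia.
have -> : ((i, j, b) \in ups U) = false.
  by apply/negbTE/imfsetP => -[k _ [_ Ej _]]; move: j0; rewrite Ej.
rewrite /= !andbF /=; congr (_ && _).
by apply/idP/idP; case: b; clear - j0; lia.
Qed.

(** V consists of positions counted from 0, dents have labels counted from 1. *)
Definition labels (w : nat) (V : {set 'I_w}) : {fset nat} := [fset (val i).+1 | i in V].

Lemma labelsP w (V : {set 'I_w}) (k : nat) :
  reflect (exists2 i : 'I_w, i \in V & k = i.+1) (k \in labels V).
Proof. by apply: (iffP (imfsetP _ _ _ _)) => -[i /= iV ->]; exists i. Qed.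

Lemma card_labels w (V : {set 'I_w}) : #|` labels V| = #|V|.
Proof.
rewrite /labels card_imfset; last by move=> i j [/val_inj].
by rewrite cardE.
Qed.

(** V runs over the possible sets of vertical lozenges across l. With E = U | D and
    I = U & D, the sum is what remains of the tiling count after the contributions
    of U alone and of D alone have been taken out. *)
Definition shuffle_weight (w y : nat) (E I : {fset nat}) : nat :=
  (\sum_(V : {set 'I_w} | (#|V| == y) && [forall i in V, (val i).+1 \notin E])
     vdm (labels V) ^ 2 * cross E (labels V) * cross I (labels V))%N.

Lemma shuffle_weight_gt0 w y (E I : {fset nat}) : (#|` E| + y <= w)%N ->
  (0 < shuffle_weight w y E I)%N.
Proof.
move=> Ey; pose A := [set i : 'I_w | (val i).+1 \notin E].
have cA : (y <= #|A|)%N.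
  have : (#|~: A| <= #|` E|)%N.
    rewrite -card_labels; apply: fsubset_leq_card; apply/fsubsetP => k /labelsP [i].
    by rewrite !inE negbK => ? ->.
  by have := cardsC A; rewrite card_ord; lia.
have : (0 < #|[set B : {set 'I_w} | (B \subset A) && (#|B| == y)]|)%N.
  by rewrite cards_draws bin_gt0.
case/card_gt0P => B; rewrite inE => /andP[BA cB].
rewrite /shuffle_weight (bigD1 B) /=; last first.
  by rewrite cB; apply/forall_inP => i /(subsetP BA); rewrite inE.
by rewrite addn_gt0 !muln_gt0 !vdm_gt0 !cross_gt0.
Qed.

Lemma fsetD_imfset w (f : 'I_w -> triangle) (A : region) (V : {set 'I_w}) (U : {fset nat})
  (h : nat -> triangle) : (forall i : 'I_w, f i = h i.+1) ->
  (A `\` [fset h k | k in U]) `\` [fset f i | i in V] = A `\` [fset h k | k in U `|` labels V].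
Proof.
move=> fh; rewrite fsetDDl; congr (_ `\` _); apply/fsetP => t; rewrite in_fsetU.
apply/orP/imfsetP => [[/imfsetP [k /= kU ->]|/imfsetP [i /= iV ->]]|[k /=]].
- by exists k => //=; rewrite in_fsetU kU.
- by exists i.+1 => //=; rewrite in_fsetU; apply/orP; right; apply/labelsP; exists i.
- rewrite in_fsetU => /orP[kU|/labelsP [i iV ->]] ->; [left|right]; apply/imfsetP.
    by exists k.
  by exists i => //=; rewrite fh.
Qed.

(** The exact shuffling theorem. Vertical lozenges across l at V turn the halves
    into semihexagons with dents U | V and D | V, which forces V to have y elements
    and to avoid U and D. By [vdm_cat], the product of the two counts is
    vdm U * vdm D times a factor in which U and D enter through
    cross U V * cross D V, and [cross_fsetUI] shows that this depends on U | D and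
    U & D only. *)
Lemma dented_hexagon_count x y (U D : {fset nat}) (w := (x + y + #|` U `|` D|)%N) :
  U `<=` positions w -> D `<=` positions w ->
  (M (dented_hexagon x y U D) * (superfact (y + #|` U|) * superfact (y + #|` D|)) =
   vdm U * vdm D * shuffle_weight w y (U `|` D) (U `&` D))%N.
Proof.
move=> Uw Dw; set p := (y + #|` U|)%N; set q := (y + #|` D|)%N.
have pw : (p <= w)%N by have := fsubset_leq_card (fsubsetUl U D); rewrite /w /p; lia.
have qw : (q <= w)%N by have := fsubset_leq_card (fsubsetUr U D); rewrite /w /q; lia.
rewrite dented_hexagon_split -/w -/p -/q.
pose f (i : 'I_w) := up_at i.+1; pose g (i : 'I_w) := down_at i.+1.
set A := trapezoid w p `\` ups U; set B := [fset reflect_tri t | t in _].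
have up_inj i j : up_at i.+1 = up_at j.+1 -> i = j.
  by move/(congr1 (fun t : triangle => t.1.1)); rewrite /up_at /=; lia.
have inj_f : injective f by move=> i j /up_inj /val_inj.
have inj_g : injective g.
  by move=> i j E; apply: inj_f; rewrite /f -!reflect_down_at; congr reflect_tri.
have adj_fg i : share_edge (f i) (g i).
  by rewrite share_edge_up_down; apply/or3P; apply: Or33; rewrite !eqxx.
have memA i j b : ((i, j, b) \in A) -> 0 <= j.
  by rewrite in_fsetD mem_trapezoid => /andP[_ /and4P[]].
have memB i j b : ((i, j, b) \in B) -> j <= -1.
  rewrite mem_reflect in_fsetD mem_trapezoid => /andP[_ /and4P[_ ? _ _]]; lia.
have fA (i : 'I_w) : (f i \in A) = (0 < p)%N && (i.+1 \notin U).
  rewrite in_fsetD mem_trapezoid /=.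
  have -> : (up_at i.+1 \in ups U) = (i.+1 \in U).
    apply/imfsetP/idP => [[k /= kU E]|iU]; last by exists i.+1.
    suff -> : i.+1 = k by [].
    by have := congr1 (fun t : triangle => t.1.1) E; rewrite /up_at /=; lia.
  rewrite andbC; congr (_ && _); have := ltn_ord i; lia.
have gB (i : 'I_w) : (g i \in B) = (0 < q)%N && (i.+1 \notin D).
  rewrite mem_reflect reflect_down_at in_fsetD mem_trapezoid /=.
  have -> : (up_at i.+1 \in ups D) = (i.+1 \in D).
    apply/imfsetP/idP => [[k /= kU E]|iU]; last by exists i.+1.
    suff -> : i.+1 = k by [].
    by have := congr1 (fun t : triangle => t.1.1) E; rewrite /up_at /=; lia.
  rewrite andbC; congr (_ && _); have := ltn_ord i; lia.
rewrite (M_split inj_f inj_g adj_fg); last 2 first.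
- apply/fdisjointP => -[[i j] b] /memA j0; apply/negP => /memB j1; lia.
- move=> [[i j] b] [[i' j'] b'] aA aB.
  case: b b' aA aB => [] []; rewrite ?share_edge_same //.
    move=> aA aB; rewrite share_edge_up_down => s.
    have j0 := memA _ _ _ aA; have j1 := memB _ _ _ aB.
    have : ((i, j, true) \in trapezoid w p) by move: aA; rewrite in_fsetD => /andP[].
    rewrite mem_trapezoid /= => /and4P[i0 _ _ iw].
    have ltiw : (`|i|%N < w)%N by lia.
    exists (Ordinal ltiw); rewrite /f /g /up_at /down_at /=; congr (_, _, _);
    clear - i0 s j0 j1; lia.
  move=> /memA j0 /memB j1; rewrite share_edgeC share_edge_up_down; clear - j0 j1; lia.
have AV (V : {set 'I_w}) : A `\` [fset f i | i in V] = trapezoid w p `\` ups (U `|` labels V).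
  exact: fsetD_imfset.
have BV (V : {set 'I_w}) : B `\` [fset g i | i in V] =
    [fset reflect_tri t | t in trapezoid w q `\` ups (D `|` labels V)].
  apply/fsetP => t; rewrite in_fsetD !mem_reflect -(fsetD_imfset (f := f)) // [RHS]in_fsetD.
  congr (~~ _ && _); apply/imfsetP/imfsetP => -[i /= iV E]; exists i => //.
    by rewrite E reflect_down_at.
  by rewrite -[t]reflect_triK E reflect_up_at.
have lw (V : {set 'I_w}) : labels V `<=` positions w.
  by apply/fsubsetP => k /labelsP [i iV ->]; rewrite mem_positions ltn_ord.
have cardU (V : {set 'I_w}) (W : {fset nat}) : [forall i in V, i.+1 \notin W] ->
    perm_eq (W `|` labels V) (W ++ labels V).
  move=> /forall_inP dis; apply: perm_fsetU_disjoint; rewrite fdisjoint_sym.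
  by apply/fdisjointP => k /labelsP [i iV ->]; exact: dis.
have countV r (W : {fset nat}) (V : {set 'I_w}) : (r <= w)%N ->
   r = (y + #|` W|)%N -> W `<=` positions w ->
   [forall i in V, i.+1 \notin W] -> (forall i, i \in V -> 0 < r)%N ->
   (M (trapezoid w r `\` ups (W `|` labels V)) * superfact r =
    if #|V| == y then vdm W * vdm (labels V) * cross W (labels V) else 0)%N.
  move=> rw Er Ww dis r0; rewrite semihexagon_count //.
  - rewrite (perm_size (cardU _ _ dis)) size_cat card_labels Er addnC eqn_add2r.
    by case: ifP => // _; rewrite (vdm_perm (cardU _ _ dis)) vdm_cat.
  - by rewrite fsubUset Ww lw.
  move=> r0'; apply/fsetP => k; rewrite in_fsetU in_fset0.
  have /cardfs0_eq -> : #|` W| = 0%N by lia.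
  by apply/negbTE/labelsP => -[i /r0]; rewrite r0'.
rewrite big_distrl /shuffle_weight big_distrr /=.
rewrite [LHS]big_mkcond [RHS]big_mkcond; apply: eq_bigr => V _.
have [ok|nok] := boolP (crossable f g A B V); last first.
  case: ifP => // /andP[/eqP cV /forall_inP dis]; case/negP: nok.
  apply/forall_inP => i iV; rewrite fA gB; have := dis i iV.
  have y0 : (0 < y)%N by rewrite -cV; apply/card_gt0P; exists i.
  by rewrite in_fsetU negb_or => /andP[-> ->]; rewrite /p /q; lia.
have okU : [forall i in V, i.+1 \notin U].
  by apply/forall_inP => i /(forall_inP ok); rewrite fA => /andP[/andP[]].
have okD : [forall i in V, i.+1 \notin D].
  by apply/forall_inP => i /(forall_inP ok); rewrite gB => /andP[_ /andP[]].
have -> : [forall i in V, (val i).+1 \notin U `|` D].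
  by apply/forall_inP => i iV; rewrite in_fsetU negb_or (forall_inP okU) ?(forall_inP okD).
rewrite andbT AV BV M_imfset; [|exact: inv_inj reflect_triK|exact: share_edge_reflect].
rewrite mulnACA !countV //; last 2 first.
- by move=> i /(forall_inP ok); rewrite gB => /andP[_ /andP[]].
- by move=> i /(forall_inP ok); rewrite fA => /andP[/andP[]].
case: ifP => // _; have := cross_fsetUI U D (labels V).
rewrite -!mulnA; move <-; ring.
Qed.

(** * Clusters along the line *)

Lemma card_positions m : #|` positions m| = m.
Proof. by rewrite card_fseq undup_id ?iota_uniq // size_iota. Qed.

Lemma cup_sub C : cup C `<=` positions (clen C).
Proof. by rewrite -cup_cdown fsubsetUl. Qed.

Lemma cdown_sub C : cdown C `<=` positions (clen C).
Proof. by rewrite -cup_cdown fsubsetUr. Qed.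

Lemma shuffling_clen C C' : shuffling C C' -> clen C' = clen C.
Proof. by case=> E _ _ _; rewrite -[LHS]card_positions -[RHS]card_positions -!cup_cdown E. Qed.

Lemma M_semihexagon f (U : {fset nat}) : U `<=` positions f ->
  (M (semihexagon #|` U| (f - #|` U|) U) * superfact #|` U| = vdm U)%N.
Proof.
move=> Uf; have := fsubset_leq_card Uf; rewrite card_positions => uf.
rewrite semihexagonE subnKC // semihexagon_count ?eqxx // => /eqP.
by rewrite cardfs_eq0 => /eqP.
Qed.

Section Placement.
Variables (k : nat) (o f : 'I_k -> nat).
Hypothesis sep : forall i j : 'I_k, (i < j)%N -> (o i + f i <= o j)%N.

Definition place (S : 'I_k -> {fset nat}) : {fset nat} :=
  \bigcup_(i <- enum 'I_k) translate (o i) (S i).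

Lemma placeP S n : reflect (exists i, exists2 s, s \in S i & n = (o i + s)%N) (n \in place S).
Proof.
apply: (iffP (bigfcupP _ _ _ _)) => [[i _ /imfsetP [s /= sS ->]]|[i [s sS ->]]].
  by exists i, s.
by exists i; rewrite ?mem_enum //; apply/imfsetP; exists s.
Qed.

Lemma placeU S T : place S `|` place T = place (fun i => S i `|` T i).
Proof.
apply/fsetP => n; rewrite in_fsetU; apply/orP/placeP.
  by case=> /placeP [i [s sS ->]]; exists i, s; rewrite // in_fsetU sS ?orbT.
by case=> i [s]; rewrite in_fsetU => /orP[] ? ->; [left|right]; apply/placeP; exists i, s.
Qed.

(** The intervals that the clusters occupy are disjoint. *)
Lemma place_inj i j s t : s \in positions (f i) -> t \in positions (f j) ->
  (o i + s = o j + t)%N -> i = j /\ s = t.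
Proof.
rewrite !mem_positions => sf tf E.
have [ij|ji|/val_inj ij] := ltngtP i j; last by subst j; split=> //; lia.
  by have := sep ij; lia.
by have := sep ji; lia.
Qed.

Lemma placeI S T :
  (forall i, S i `<=` positions (f i)) -> (forall i, T i `<=` positions (f i)) ->
  place S `&` place T = place (fun i => S i `&` T i).
Proof.
move=> Sf Tf; apply/fsetP => n; rewrite in_fsetI; apply/andP/placeP.
  case=> /placeP [i [s sS ->]] /placeP [j [t tT E]].
  have [Eij Est] := place_inj (fsubsetP (Sf i) _ sS) (fsubsetP (Tf j) _ tT) E; subst j t.
  by exists i, s; rewrite // in_fsetI sS.
by case=> i [s]; rewrite in_fsetI => /andP[? ?] ->; split; apply/placeP; exists i, s.
Qed.

Lemma perm_place S : (forall i, S i `<=` positions (f i)) ->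
  perm_eq (place S) [seq (o i + s)%N | i <- enum 'I_k, s <- S i].
Proof.
move=> Sf; apply: uniq_perm; first exact: fset_uniq.
  apply: allpairs_uniq_dep => [|i _|]; [exact: enum_uniq|exact: fset_uniq|].
  move=> u v /allpairsPdep [i [s [_ sS Eu]]] /allpairsPdep [j [t [_ tT Ev]]].
  rewrite {u}Eu {v}Ev /= => E.
  by have [-> ->] := place_inj (fsubsetP (Sf i) _ sS) (fsubsetP (Sf j) _ tT) E.
move=> n; apply/placeP/allpairsPdep => [[i [s sS ->]]|[i [s [_ sS ->]]]].
  by exists i, s; rewrite mem_enum.
by exists i, s.
Qed.

Lemma card_place S : (forall i, S i `<=` positions (f i)) ->
  #|` place S| = (\sum_i #|` S i|)%N.
Proof.
move=> Sf; rewrite (perm_size (perm_place Sf)) size_allpairs_dep sumnE big_map.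
by rewrite big_enum.
Qed.

(** Since [gap] is 1 on decreasing pairs, the pair (j, i) with i < j contributes
    nothing more, and (i, i) contributes the Vandermonde product of one cluster. *)
Definition pair_gap S (i j : 'I_k) : nat :=
  (\prod_(a <- S i) \prod_(b <- S j) gap (o i + a) (o j + b))%N.

Lemma vdm_place S : (forall i, S i `<=` positions (f i)) ->
  vdm (place S) = (\prod_i \prod_j pair_gap S i j)%N.
Proof.
move=> Sf; rewrite (vdm_perm (perm_place Sf)) vdm_gap big_allpairs_dep big_enum /=.
apply: eq_bigr => i _; rewrite /pair_gap [RHS]exchange_big /=; apply: eq_bigr => a _.
by rewrite big_allpairs_dep big_enum.
Qed.

Lemma pair_gap_diag S i : pair_gap S i i = vdm (S i).
Proof.
rewrite vdm_gap; apply: eq_bigr => a _; apply: eq_bigr => b _.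
by rewrite /gap ltn_add2l subnDl.
Qed.

Lemma pair_gap_gt S (i j : 'I_k) : (forall i, S i `<=` positions (f i)) -> (j < i)%N ->
  pair_gap S i j = 1%N.
Proof.
move=> Sf ji; rewrite /pair_gap big_seq big1 // => a aS; rewrite big_seq big1 // => b bS.
have := fsubsetP (Sf i) _ aS; have := fsubsetP (Sf j) _ bS; rewrite !mem_positions.
by have := sep ji; rewrite /gap; case: ifP => //; lia.
Qed.

Lemma pair_gap_lt S (i j : 'I_k) : (forall i, S i `<=` positions (f i)) -> (i < j)%N ->
  pair_gap S i j = (\prod_(a <- S i) \prod_(b <- S j) ((o j + b) - (o i + a)))%N.
Proof.
move=> Sf ij; apply: eq_big_seq => a aS; apply: eq_big_seq => b bS.
have := fsubsetP (Sf i) _ aS; have := fsubsetP (Sf j) _ bS; rewrite !mem_positions.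
by have := sep ij; rewrite /gap; case: ifP => //; lia.
Qed.

End Placement.

Lemma offset_sep k (C : 'I_k -> dent_cluster) d (i j : 'I_k) : (i < j)%N ->
  (offset C d i + clen (C i) <= offset C d j)%N.
Proof.
move=> ij; rewrite /offset addnAC leq_add //.
  rewrite [leqRHS](bigID (fun l : 'I_k => (l < i)%N)) /= leq_add //.
    rewrite [leqRHS](eq_bigl (fun l : 'I_k => (l < i)%N)) // => l; lia.
  by rewrite (bigD1 i) /= ?ij ?ltnn // leq_addr.
rewrite [leqRHS](bigID (fun l : 'I_k.-1 => (l < i)%N)) /=.
rewrite [X in (_ <= X + _)%N](eq_bigl (fun l : 'I_k.-1 => (l < i)%N)) ?leq_addr // => l; lia.
Qed.

Lemma offset_bound k (C : 'I_k -> dent_cluster) d (i : 'I_k) :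
  (offset C d i + clen (C i) <= \sum_j clen (C j) + \sum_j d j)%N.
Proof.
rewrite /offset addnAC leq_add //.
  rewrite [leqRHS](bigID (fun l : 'I_k => (l < i)%N)) /= leq_add //.
  by rewrite (bigD1 i) ?ltnn //= leq_addr.
by rewrite [leqRHS](bigID (fun l : 'I_k.-1 => (l < i)%N)) /= leq_addr.
Qed.

Lemma eq_offset k (C C' : 'I_k -> dent_cluster) d : (forall i, clen (C' i) = clen (C i)) ->
  offset C' d =1 offset C d.
Proof. by move=> E i; rewrite /offset; congr (_ + _)%N; apply: eq_bigr => j _. Qed.

Section ClusterCount.
Variables (k x y : nat) (d : 'I_k.-1 -> nat).
Hypothesis hsum : (\sum_(i < k.-1) d i = x + y)%N.

Lemma cluster_hexagon_count (C : 'I_k -> dent_cluster)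
  (U := place (offset C d) (fun i => cup (C i))) (D := place (offset C d) (fun i => cdown (C i))) :
  (M (cluster_hexagon C d x y) *
     (superfact (y + \sum_i #|` cup (C i)|) * superfact (y + \sum_i #|` cdown (C i)|)) =
   vdm U * vdm D * shuffle_weight (x + y + #|` U `|` D|) y (U `|` D) (U `&` D))%N.
Proof.
have sepC := @offset_sep k C d.
have cU : #|` U| = (\sum_i #|` cup (C i)|)%N.
  by apply: (card_place sepC) => i; exact: cup_sub.
have cD : #|` D| = (\sum_i #|` cdown (C i)|)%N.
  by apply: (card_place sepC) => i; exact: cdown_sub.
have cUD : #|` U `|` D| = (\sum_i clen (C i))%N.
  rewrite placeU (card_place sepC) => [|i]; last by rewrite cup_cdown.
  by apply: eq_bigr => i _; rewrite cup_cdown card_positions.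
have sub S : (forall i, S i `<=` positions (clen (C i))) ->
    place (offset C d) S `<=` positions (x + y + #|` U `|` D|).
  move=> Sf; apply/fsubsetP => n /placeP [i [s sS ->]].
  have := fsubsetP (Sf i) _ sS; rewrite !mem_positions cUD -hsum.
  case/andP=> s0 sf; rewrite addn_gt0 s0 orbT /= addnC [leqRHS]addnC.
  by apply: leq_trans (offset_bound C d i); rewrite addnC leq_add2l.
rewrite -cU -cD; apply: dented_hexagon_count; apply: sub => i; [exact: cup_sub|exact: cdown_sub].
Qed.

Lemma cluster_hexagon_gt0 (C : 'I_k -> dent_cluster) : (0 < M (cluster_hexagon C d x y))%N.
Proof.
have := cluster_hexagon_count C; cbv zeta; set U := place _ _; set D := place _ _ => E.
suff : (0 < vdm U * vdm D * shuffle_weight (x + y + #|` U `|` D|) y (U `|` D) (U `&` D))%N.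
  by rewrite -E !muln_gt0 => /andP[].
by rewrite !muln_gt0 !vdm_gt0 shuffle_weight_gt0 //; lia.
Qed.

(** The unknown sum over V is the same positive number for both families of
    clusters, and cancels. *)
Lemma cluster_hexagon_shuffle (C C' : 'I_k -> dent_cluster) :
  (forall i, shuffling (C i) (C' i)) ->
  (M (cluster_hexagon C d x y) *
     (vdm (place (offset C d) (fun i => cup (C' i))) *
      vdm (place (offset C d) (fun i => cdown (C' i)))) =
   M (cluster_hexagon C' d x y) *
     (vdm (place (offset C d) (fun i => cup (C i))) *
      vdm (place (offset C d) (fun i => cdown (C i)))))%N.
Proof.
move=> sh; have eo := eq_offset d (fun i => shuffling_clen (sh i)).
have eplace S : place (offset C' d) S = place (offset C d) S.
  by rewrite /place; apply: eq_bigr => i _; rewrite eo.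
have := cluster_hexagon_count C; have := cluster_hexagon_count C'; cbv zeta; rewrite !eplace.
have -> : (\sum_i #|` cup (C' i)| = \sum_i #|` cup (C i)|)%N.
  by apply: eq_bigr => i _; case: (sh i).
have -> : (\sum_i #|` cdown (C' i)| = \sum_i #|` cdown (C i)|)%N.
  by apply: eq_bigr => i _; case: (sh i).
have sepC := @offset_sep k C d.
have eclen i := shuffling_clen (sh i).
rewrite !placeU !(placeI sepC) => [|i|i|i|i];
  rewrite -?eclen ?cup_sub ?cdown_sub ?eclen ?cup_sub ?cdown_sub //.
have -> : place (offset C d) (fun i => cup (C' i) `|` cdown (C' i)) =
          place (offset C d) (fun i => cup (C i) `|` cdown (C i)).
  by apply: eq_bigr => i _; case: (sh i) => -> _ _ _.
have -> : place (offset C d) (fun i => cup (C' i) `&` cdown (C' i)) =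
          place (offset C d) (fun i => cup (C i) `&` cdown (C i)).
  by apply: eq_bigr => i _; case: (sh i) => _ -> _ _.
set E := place _ _; set I := place _ _; set K := shuffle_weight _ _ _ _.
set s := superfact _; set s' := superfact _ => H' H.
have K0 : (0 < K)%N.
  by apply: shuffle_weight_gt0; lia.
have s0 n : (0 < superfact n)%N by apply: prodn_gt0 => i; exact: fact_gt0.
apply/eqP; rewrite -(eqn_pmul2r (m := s * s' * K)%N) ?muln_gt0 ?s0 ?K0 //; apply/eqP.
transitivity ((M (cluster_hexagon C d x y) * (s * s')) * K *
   (vdm (place (offset C d) (fun i => cup (C' i))) *
      vdm (place (offset C d) (fun i => cdown (C' i)))))%N; first ring.
rewrite H; transitivity ((vdm (place (offset C d) (fun i => cup (C' i))) *
  vdm (place (offset C d) (fun i => cdown (C' i))) * K) * K *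
  (vdm (place (offset C d) (fun i => cup (C i))) *
      vdm (place (offset C d) (fun i => cdown (C i)))))%N; first ring.
rewrite -H'; ring.
Qed.

End ClusterCount.

(** * The limit for distant clusters *)

Local Open Scope classical_set_scope.
Local Open Scope ring_scope.

Lemma cvg_prod_seq (R : realType) (I : eqType) (r : seq I) (u : I -> nat -> R) (l : I -> R) :
  (forall i, i \in r -> u i @ \oo --> l i) ->
  (fun n => \prod_(i <- r) u i n) @ \oo --> \prod_(i <- r) l i.
Proof.
elim: r => [|i r IHr] ul.
  under eq_fun do rewrite big_nil.
  by rewrite big_nil; exact: cvg_cst.
under eq_fun do rewrite big_cons.
rewrite big_cons; apply: cvgM; first by apply: ul; rewrite mem_head.
by apply: IHr => j jr; apply: ul; rewrite inE jr orbT.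
Qed.

Lemma prod_seq_const (R : pzSemiRingType) (I : Type) (r : seq I) (c : R) :
  \prod_(i <- r) c = c ^+ size r.
Proof. by rewrite big_const_seq count_predT iter_mulr_1. Qed.

Section Limit.
Variable R : realType.

Lemma cvg_affine_ratio (f g f' g' : nat) :
  (forall n, f + n * g <= f' + n * g')%N ->
  (fun n => ((f' + n.+1 * g') - (f + n.+1 * g))%N%:R / n.+1%:R : R) @ \oo --> (g'%:R - g%:R : R).
Proof.
move=> le_fg; rewrite -[X in _ --> X]addr0.
have -> : (fun n => ((f' + n.+1 * g') - (f + n.+1 * g))%N%:R / n.+1%:R : R) =
          (fun n => (g'%:R - g%:R) + (f'%:R - f%:R) * harmonic n).
  apply/funext => n; rewrite natrB // (natrD _ f') (natrD _ f) !natrM /harmonic /=.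
  have N0 : n.+1%:R != 0 :> R by rewrite pnatr_eq0.
  by move: (n.+1%:R : R) N0 => N N0; field.
apply: cvgD; first exact: cvg_cst.
rewrite -[X in _ --> X](mulr0 (f'%:R - f%:R)); apply: cvgM; first exact: cvg_cst.
exact: cvg_harmonic.
Qed.

Variables (k : nat) (C : 'I_k -> dent_cluster) (d : 'I_k.-1 -> nat).
Hypothesis hd : forall i, (0 < d i)%N.

Definition len_before (i : 'I_k) : nat := (\sum_(j < k | (j < i)%N) clen (C j))%N.
Definition dist_before (i : 'I_k) : nat := (\sum_(j < k.-1 | (j < i)%N) d j)%N.

Lemma offset_scale n i : offset C (fun j => n * d j)%N i = (len_before i + n * dist_before i)%N.
Proof. by rewrite /offset -big_distrr. Qed.

Lemma dist_before_lt (i j : 'I_k) : (i < j)%N -> (dist_before i < dist_before j)%N.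
Proof.
move=> ij; have ik : (i < k.-1)%N by have := ltn_ord j; lia.
rewrite /dist_before [X in (_ < X)%N](bigID (fun l : 'I_k.-1 => (l < i)%N)) /=.
rewrite [X in (_ < X + _)%N](eq_bigl (fun l : 'I_k.-1 => (l < i)%N)); last by move=> l; lia.
rewrite -[X in (X < _)%N]addn0 ltn_add2l (bigD1 (Ordinal ik)) /= ?ij ?ltnn //.
by rewrite addn_gt0 hd.
Qed.

(** For i < j every distance between the two clusters is asymptotic to n * delta,
    delta being the sum of the distances d between them, whatever the shape of the
    clusters. Both products have the same number of factors, so after division by
    the same power of n they tend to the same limit, which is not 0. *)
Lemma cvg_pair_gap_ratio (S S' : 'I_k -> {fset nat}) (i j : 'I_k) :
  (forall i, S i `<=` positions (clen (C i)))%fset ->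
  (forall i, S' i `<=` positions (clen (C i)))%fset ->
  (forall i, #|` S' i| = #|` S i|)%fset ->
  (fun n => (pair_gap (offset C (fun j => n.+1 * d j)%N) S i j)%:R
            / (pair_gap (offset C (fun j => n.+1 * d j)%N) S' i j)%:R : R) @ \oo -->
  (if i == j then (vdm (S i))%:R / (vdm (S' i))%:R else 1 : R).
Proof.
move=> Sf S'f eS; have [->|ne] := eqVneq i j.
  by under eq_fun do rewrite !pair_gap_diag; exact: cvg_cst.
have sep n := @offset_sep k C (fun j => n * d j)%N.
have [ij|ji|/val_inj ij] := ltngtP i j; last by rewrite ij eqxx in ne.
  2: by under eq_fun do rewrite !(pair_gap_gt (@sep _)) //; rewrite divr1; exact: cvg_cst.
pose delta : R := (dist_before j)%:R - (dist_before i)%:R.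
have delta0 : delta != 0 by rewrite subr_eq0 eqr_nat gtn_eqF ?dist_before_lt.
have lim T : (forall i, T i `<=` positions (clen (C i)))%fset ->
    (fun n => (pair_gap (offset C (fun j => n.+1 * d j)%N) T i j)%:R
       / n.+1%:R ^+ (size (T j) * size (T i)) : R) @ \oo --> delta ^+ (size (T j) * size (T i)).
  move=> Tf.
  have -> : (fun n => (pair_gap (offset C (fun j => n.+1 * d j)%N) T i j)%:R
       / n.+1%:R ^+ (size (T j) * size (T i)) : R) =
     (fun n => \prod_(a <- T i) \prod_(b <- T j)
        ((((len_before j + b) + n.+1 * dist_before j)
          - ((len_before i + a) + n.+1 * dist_before i))%N%:R / n.+1%:R)).
    apply/funext => n; rewrite (pair_gap_lt (@sep _)) // !offset_scale.
    rewrite natr_prod exprM -!prod_seq_const -prodf_div; apply: eq_bigr => a _.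
    rewrite natr_prod -prodf_div; apply: eq_bigr => b _.
    by rewrite !(addnAC _ _ (n.+1 * _)%N).
  rewrite exprM -!prod_seq_const; apply: cvg_prod_seq => a aT.
  apply: cvg_prod_seq => b bT.
  apply: cvg_affine_ratio => n.
  have := fsubsetP (Tf i) _ aT; have := fsubsetP (Tf j) _ bT; rewrite !mem_positions.
  by have := sep n i j ij; rewrite !offset_scale; lia.
set m := (size (S j) * size (S i))%N.
have -> : (fun n => (pair_gap (offset C (fun j => n.+1 * d j)%N) S i j)%:R
            / (pair_gap (offset C (fun j => n.+1 * d j)%N) S' i j)%:R : R) =
          (fun n => ((pair_gap (offset C (fun j => n.+1 * d j)%N) S i j)%:R / n.+1%:R ^+ m) *
             ((pair_gap (offset C (fun j => n.+1 * d j)%N) S' i j)%:R / n.+1%:R ^+ m)^-1).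
  by apply/funext => n; rewrite invf_div mulrA divfK // expf_neq0 // pnatr_eq0.
rewrite -[X in _ --> X](mulfV (expf_neq0 m delta0)).
apply: cvgM; first exact: (lim S Sf).
apply: cvgV; first exact: expf_neq0.
by have := lim S' S'f; rewrite !eS.
Qed.

Lemma cvg_vdm_place_ratio (S S' : 'I_k -> {fset nat}) :
  (forall i, S i `<=` positions (clen (C i)))%fset ->
  (forall i, S' i `<=` positions (clen (C i)))%fset ->
  (forall i, #|` S' i| = #|` S i|)%fset ->
  (fun n => (vdm (place (offset C (fun j => n.+1 * d j)%N) S))%:R
            / (vdm (place (offset C (fun j => n.+1 * d j)%N) S'))%:R : R) @ \oo -->
  (\prod_i ((vdm (S i))%:R / (vdm (S' i))%:R) : R).
Proof.
move=> Sf S'f eS.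
have sep n := @offset_sep k C (fun j => n * d j)%N.
have -> : (fun n => (vdm (place (offset C (fun j => n.+1 * d j)%N) S))%:R
            / (vdm (place (offset C (fun j => n.+1 * d j)%N) S'))%:R : R) =
    (fun n => \prod_i \prod_j
       ((pair_gap (offset C (fun j => n.+1 * d j)%N) S i j)%:R
            / (pair_gap (offset C (fun j => n.+1 * d j)%N) S' i j)%:R)).
  apply/funext => n; rewrite !(vdm_place (@sep _)) // !natr_prod -prodf_div.
  by apply: eq_bigr => i _; rewrite !natr_prod -prodf_div.
have -> : \prod_i ((vdm (S i))%:R / (vdm (S' i))%:R) =
   \prod_i \prod_j (if i == j then (vdm (S i))%:R / (vdm (S' i))%:R else 1 : R).
  by apply: eq_bigr => i _; rewrite -big_mkcond /= (big_pred1 i) // => j; rewrite eq_sym.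
by apply: cvg_prod_seq => i _; apply: cvg_prod_seq => j _; exact: cvg_pair_gap_ratio.
Qed.

(** The superfactorials in the counts of semihexagons depend on the numbers of
    dents only. *)
Lemma splus_sminus_ratio (c c' : dent_cluster) : shuffling c c' ->
  (splus c)%:R * (sminus c)%:R / ((splus c')%:R * (sminus c')%:R) =
  ((vdm (cup c))%:R / (vdm (cup c'))%:R) * ((vdm (cdown c))%:R / (vdm (cdown c'))%:R) :> R.
Proof.
move=> sh; have ec := shuffling_clen sh; case: sh => _ _ eu ed.
have sf0 n : (superfact n)%:R != 0 :> R.
  by rewrite pnatr_eq0 -lt0n; apply: prodn_gt0 => i; exact: fact_gt0.
have E f (U : {fset nat}) : (U `<=` positions f)%fset ->
    (vdm U)%:R = (M (semihexagon #|` U| (f - #|` U|) U))%:R * (superfact #|` U|)%:R :> R.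
  by move=> Uf; rewrite -natrM M_semihexagon.
have R1 (p q s : R) : s != 0 -> p * s / (q * s) = p / q.
  by move=> s0; rewrite invfM mulrACA divff // mulr1.
rewrite (E _ _ (cup_sub c)) (E _ _ (cup_sub c')) (E _ _ (cdown_sub c)) (E _ _ (cdown_sub c')).
rewrite eu ed !R1 // invfM mulrACA /splus /sminus.
by rewrite eu ed.
Qed.

End Limit.

Theorem corollary3p1 (R : realType) (x y k : nat) (hk : (0 < k)%N)
    (d : 'I_k.-1 -> nat) (hd : forall i, (0 < d i)%N)
    (hsum : (\sum_(i < k.-1) d i = x + y)%N)
    (C C' : 'I_k -> dent_cluster) (hC : forall i, shuffling (C i) (C' i)) :
  (fun N : nat =>
     (M (cluster_hexagon C (fun i => N * d i)%N (N * x) (N * y)))%:R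
     / (M (cluster_hexagon C' (fun i => N * d i)%N (N * x) (N * y)))%:R : R)
    @ \oo -->
  (\prod_(i < k) (((splus (C i))%:R * (sminus (C i))%:R)
                  / ((splus (C' i))%:R * (sminus (C' i))%:R)) : R).
Proof.
rewrite -cvg_shiftS /=.
under eq_bigr do rewrite splus_sminus_ratio //.
rewrite big_split /=.
have hN N : (\sum_(i < k.-1) N * d i = N * x + N * y)%N.
  by rewrite -big_distrr /= hsum mulnDr.
have cup'_sub i : (cup (C' i) `<=` positions (clen (C i)))%fset.
  by rewrite -(shuffling_clen (hC i)) cup_sub.
have cdown'_sub i : (cdown (C' i) `<=` positions (clen (C i)))%fset.
  by rewrite -(shuffling_clen (hC i)) cdown_sub.
pose o N := offset C (fun j => N.+1 * d j)%N.
have -> : (fun N : nat =>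
     (M (cluster_hexagon C (fun i => N.+1 * d i)%N (N.+1 * x) (N.+1 * y)))%:R
     / (M (cluster_hexagon C' (fun i => N.+1 * d i)%N (N.+1 * x) (N.+1 * y)))%:R : R) =
   (fun N =>
     ((vdm (place (o N) (fun i => cup (C i))))%:R
      / (vdm (place (o N) (fun i => cup (C' i))))%:R) *
     ((vdm (place (o N) (fun i => cdown (C i))))%:R
      / (vdm (place (o N) (fun i => cdown (C' i))))%:R)).
  have v0 s : (vdm s)%:R != 0 :> R by rewrite pnatr_eq0 -lt0n vdm_gt0.
  apply/funext => N; rewrite mulrACA -invfM -!natrM; apply/eqP.
  rewrite eqr_div ?natrM ?mulf_neq0 // ?pnatr_eq0 -?lt0n ?(cluster_hexagon_gt0 (hN _)) //.
  by rewrite -!natrM (cluster_hexagon_shuffle (hN _) hC) mulnC.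
apply: cvgM.
  by apply: cvg_vdm_place_ratio => // i; [exact: cup_sub|case: (hC i)].
by apply: cvg_vdm_place_ratio => // i; [exact: cdown_sub|case: (hC i)].
Qed.
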